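(* Fix $d$. There is an algorithm which, given a set $S\subset\mathbb{R}^d$ of $n$ points and a positive integer $k$, computes in $O_d(n^2)$ time a packing formed by $\Omega_d(n/k)$ homothets of $B^d$ each containing at least $k$ points of $S$.
   Context: $B^d$ is the unit Euclidean ball in $\mathbb{R}^d$; its homothets are Euclidean balls $\lambda B^d+x$ ($\lambda>0$). A packing is a family of sets with pairwise disjoint interiors. Constants hidden in $O_d,\Omega_d$ depend only on $d$.
   Formalization: The formal theorem assumes k ≤ n: for k > n ≥ 1 no ball contains k points of S, so no packing with a positive number of such balls exists and the claim fails as written. *)

(* Defs.v *)
From Stdlib Require Import Reals ZArith List Lia Lra.
Open Scope R_scope.

(* Model of computation: a real RAM (unit-cost arithmetic on exact     *)
(* reals and on natural numbers, indirect addressing, comparisons).    *)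
(* No floor / real-to-integer conversion.  Program constants are       *)
(* integers.  Cost = number of executed instructions.                  *)
Inductive instr : Type :=
| IConst (i c : nat)
| IAdd (i j k : nat)
| ISub (i j k : nat)
| IMul (i j k : nat)
| ILoad (i j : nat)
| IStore (i j : nat)
| RConst (i : nat) (z : Z)
| RAdd (i j k : nat)
| RSub (i j k : nat)
| RMul (i j k : nat)
| RDiv (i j k : nat)
| RSqrt (i j : nat)
| RLoad (i j : nat)
| RStore (i j : nat)
| OfNat (i j : nat)
| JLt (j k t : nat)
| JRLt (j k t : nat)
| Halt.

Record config : Type := Config { pc : nat; imem : nat -> nat; rmem : nat -> R }.

Definition updN (f : nat -> nat) (a v : nat) : nat -> nat :=
  fun x => if Nat.eqb x a then v else f x.
Definition updR (f : nat -> R) (a : nat) (v : R) : nat -> R :=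
  fun x => if Nat.eqb x a then v else f x.

Definition step (p : list instr) (c : config) : config :=
  let '(Config q M X) := c in
  let nx := S q in
  match nth_error p q with
  | None => c
  | Some ins =>
    match ins with
    | IConst i v => Config nx (updN M i v) X
    | IAdd i j k => Config nx (updN M i (M j + M k)%nat) X
    | ISub i j k => Config nx (updN M i (M j - M k)%nat) X
    | IMul i j k => Config nx (updN M i (M j * M k)%nat) X
    | ILoad i j => Config nx (updN M i (M (M j))) X
    | IStore i j => Config nx (updN M (M i) (M j)) X
    | RConst i z => Config nx M (updR X i (IZR z))
    | RAdd i j k => Config nx M (updR X i (X j + X k))
    | RSub i j k => Config nx M (updR X i (X j - X k))
    | RMul i j k => Config nx M (updR X i (X j * X k))
    | RDiv i j k => Config nx M (updR X i (X j / X k))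
    | RSqrt i j => Config nx M (updR X i (sqrt (X j)))
    | RLoad i j => Config nx M (updR X i (X (M j)))
    | RStore i j => Config nx M (updR X (M i) (X j))
    | OfNat i j => Config nx M (updR X i (INR (M j)))
    | JLt j k t => Config (if Nat.ltb (M j) (M k) then t else nx) M X
    | JRLt j k t => Config (if Rlt_dec (X j) (X k) then t else nx) M X
    | Halt => c
    end
  end.

Definition halted (p : list instr) (c : config) : Prop :=
  match nth_error p (pc c) with
  | None => True
  | Some Halt => True
  | Some _ => False
  end.

Definition run (p : list instr) (t : nat) (c : config) : config :=
  Nat.iter t (step p) c.

(* Input: imem 0 = n, imem 1 = k, rmem (i*d + j) = j-th coordinate of  *)
(* the i-th point (i < n, j < d); everything else 0.                   *)
Definition init_config (d n k : nat) (Spts : nat -> nat -> R) : config :=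
  Config 0%nat
    (fun a => match a with 0%nat => n | 1%nat => k | _ => 0%nat end)
    (fun a => if Nat.ltb a (n * d) then Spts (a / d)%nat (a mod d)%nat else 0).

Definition out_count (c : config) : nat := imem c 0.
Definition out_center (d : nat) (c : config) (i : nat) : nat -> R :=
  fun j => rmem c (i * (d + 1) + j)%nat.
Definition out_radius (d : nat) (c : config) (i : nat) : R :=
  rmem c (i * (d + 1) + d)%nat.

(* Euclidean geometry in R^d; a point is x : nat -> R, coordinates     *)
(* 0..d-1 are the relevant ones.                                       *)
Fixpoint sumsq (d : nat) (x y : nat -> R) : R :=
  match d with
  | 0%nat => 0
  | S d' => sumsq d' x y + (x d' - y d') ^ 2
  end.

Definition edist (d : nat) (x y : nat -> R) : R := sqrt (sumsq d x y).

Definition distinct_pts (d n : nat) (Spts : nat -> nat -> R) : Prop :=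
  forall i j, (i < n)%nat -> (j < n)%nat -> i <> j ->
    exists l, (l < d)%nat /\ Spts i l <> Spts j l.

Fixpoint count_in (d n : nat) (Spts : nat -> nat -> R) (c : nat -> R) (r : R) : nat :=
  match n with
  | 0%nat => 0%nat
  | S n' => (count_in d n' Spts c r +
             (if Rle_dec (edist d (Spts n') c) r then 1 else 0))%nat
  end.

Definition ball_packing (d m : nat) (c : nat -> nat -> R) (r : nat -> R) : Prop :=
  forall i j, (i < m)%nat -> (j < m)%nat -> i <> j ->
    ~ (exists x : nat -> R, edist d x (c i) < r i /\ edist d x (c j) < r j).

Definition good_output (d n k : nat) (Spts : nat -> nat -> R) (cst : R)
  (cf : config) : Prop :=
  let m := out_count cf in
  cst * INR n / INR k <= INR m /\
  (forall i, (i < m)%nat ->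
     0 < out_radius d cf i /\
     (k <= count_in d n Spts (out_center d cf i) (out_radius d cf i))%nat) /\
  ball_packing d m (out_center d cf) (out_radius d cf).

(* Main.v *)
(* For each point p let r_p be its distance to some neighbour of rank between k
   and 64k.  Take the balls B(p, r_p) greedily by increasing radius, discarding those
   that meet a chosen one.  A chosen ball B(q, r_q) discards O_d(k) points p, all with
   r_p >= r_q: those within 2 r_q of q are split into cells of diameter < r_q, the
   others according to their direction from q, and in each cell all points lie in the
   open ball B(p, r_p) of a single p, which has at most 64k points.  So Omega_d(n/k)
   balls are chosen.

   To find r_p in linear time, start with all distances and, while more than 64k are
   left, keep those below a pivot of rank between N/64 and 3N/4, where N is their
   number.  The pivot comes from rounds that cut the list into blocks of length
   s = 64, 128, 256, ..., sort each block and keep every fourth element.  A round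
   costs O(N s), which decreases geometrically, and the rank errors, of order n/s,
   are summable; once a single block is left, a suitable element of it is the pivot. *)

Require Import Defs.
From Stdlib Require Import Reals ZArith List Lia Lra Bool Arith.
Import ListNotations.
Local Open Scope nat_scope.

(** * A structured language with step counts *)

(** Losing a constant factor in a rank costs only a constant factor in the number of balls, so exact
    selection is avoided. The machine divides no naturals and has no procedure calls; hence
    selection by thinning, where block lengths and ranks merely double and nothing recurses.
    Distances may coincide, so the rank of a radius is two-sided: at least [k] points in the closed
    ball, at most [64 k] in the open one. The crowding argument therefore has to end in strict
    inequalities, and a ball is discarded only if the open balls overlap. The nearest live ball size
    is found as a maximum of inverse radii, where 0 can mark a removed point without any infinite
    value. Since the claim concerns raw machine code and exact step counts, the algorithm is written
    in a small while language over named arrays, verified there with triples that carry time bounds,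
    and translated in two stages: named arrays to flat memory, structured control to jumps. *)

Inductive test : Type := TN (j k : nat) | TR (j k : nat).

Inductive cmd (B : Type) : Type :=
| Blk (l : list B)
| Seq (c1 c2 : cmd B)
| If (t : test) (c : cmd B)
| While (t : test) (c : cmd B).
Arguments Blk {B} l.
Arguments Seq {B} c1 c2.
Arguments If {B} t c.
Arguments While {B} t c.

Local Notation "c1 ;; c2" := (Seq c1 c2) (at level 65, right associativity).

Section Semantics.
Variables (B ST : Type) (ok : B -> ST -> Prop) (act : B -> ST -> ST)
  (val : test -> ST -> bool).

Fixpoint oks (l : list B) (s : ST) : Prop :=
  match l with [] => True | b :: l' => ok b s /\ oks l' (act b s) end.

Fixpoint acts (l : list B) (s : ST) : ST :=
  match l with [] => s | b :: l' => acts l' (act b s) end.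

(* The step counts are those of the code produced by [compile]: a failed test
   costs a second, unconditional jump, and a loop iteration costs a jump back. *)
Inductive exec : cmd B -> ST -> nat -> ST -> Prop :=
| ex_blk l s : oks l s -> exec (Blk l) s (length l) (acts l s)
| ex_seq c1 c2 s s1 s2 t1 t2 :
    exec c1 s t1 s1 -> exec c2 s1 t2 s2 -> exec (Seq c1 c2) s (t1 + t2) s2
| ex_if_true t c s s' n :
    val t s = true -> exec c s n s' -> exec (If t c) s (S n) s'
| ex_if_false t c s : val t s = false -> exec (If t c) s 2 s
| ex_while_true t c s s1 s2 n1 n2 :
    val t s = true -> exec c s n1 s1 -> exec (While t c) s1 n2 s2 ->
    exec (While t c) s (n1 + n2 + 2) s2
| ex_while_false t c s : val t s = false -> exec (While t c) s 2 s.

(** A total correctness triple with a time bound. The existence of a derivation of [exec] already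
    includes termination and, through [oks], the legality of every array access. *)
Definition tot (c : cmd B) (s : ST) (T : nat) (Q : ST -> Prop) : Prop :=
  exists t s', exec c s t s' /\ t <= T /\ Q s'.

Lemma tot_weaken c s T T' (Q Q' : ST -> Prop) :
  tot c s T Q -> T <= T' -> (forall s', Q s' -> Q' s') -> tot c s T' Q'.
Proof.
  intros (t & s' & He & Ht & HQ) HT HQQ. exists t, s'.
  split; [assumption | split; [lia | auto]].
Qed.

Lemma tot_blk l s T (Q : ST -> Prop) :
  oks l s -> length l <= T -> Q (acts l s) -> tot (Blk l) s T Q.
Proof.
  intros Ho HT HQ. exists (length l), (acts l s).
  split; [now constructor | auto].
Qed.

Lemma tot_seq c1 c2 s T1 T2 T (Q : ST -> Prop) :
  tot c1 s T1 (fun s1 => tot c2 s1 T2 Q) -> T1 + T2 <= T -> tot (Seq c1 c2) s T Q.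
Proof.
  intros (t1 & s1 & He1 & Ht1 & t2 & s2 & He2 & Ht2 & HQ) HT.
  exists (t1 + t2), s2. split; [now econstructor; eauto | split; [lia | auto]].
Qed.

Lemma tot_if t c s T T' (Q : ST -> Prop) :
  (val t s = true -> tot c s T Q) -> (val t s = false -> Q s) -> T + 2 <= T' ->
  tot (If t c) s T' Q.
Proof.
  intros H1 H2 HT. destruct (val t s) eqn:E.
  - destruct (H1 eq_refl) as (n & s' & He & Hn & HQ).
    exists (S n), s'. split; [now constructor | split; [lia | auto]].
  - exists 2, s. split; [now constructor | split; [lia | auto]].
Qed.

(** The potential is variant and cost account at once: an iteration lowers it by its own cost plus
    two jumps, and the remaining 2 pays for leaving the loop. *)
Lemma tot_while (Inv : ST -> Prop) (Phi : ST -> nat) t c (Q : ST -> Prop) :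
  (forall s, Inv s -> val t s = true ->
     exists T, tot c s T (fun s' => Inv s' /\ Phi s' + T + 2 <= Phi s)) ->
  (forall s, Inv s -> val t s = false -> Q s) ->
  forall s T, Inv s -> Phi s + 2 <= T -> tot (While t c) s T Q.
Proof.
  intros Hb Hx.
  assert (G : forall m s, Phi s < m -> Inv s -> tot (While t c) s (Phi s + 2) Q).
  { induction m as [|m IH]; intros s Hm Hi; [lia|].
    destruct (val t s) eqn:E.
    - destruct (Hb s Hi E) as (T & n1 & s1 & He1 & Hn1 & Hi1 & Hp).
      destruct (IH s1 ltac:(lia) Hi1) as (n2 & s2 & He2 & Hn2 & HQ).
      exists (n1 + n2 + 2), s2.
      split; [now eapply ex_while_true; eauto | split; [lia | auto]].
    - exists 2, s. split; [now constructor | split; [lia | auto]]. }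
  intros s T Hi HT. eapply tot_weaken; [apply (G (S (Phi s)) s); auto | lia | auto].
Qed.

End Semantics.
Arguments oks {B ST}. Arguments acts {B ST}.
Arguments exec {B ST}. Arguments tot {B ST}.

(** * Compilation to the machine *)

Definition flat : Type := ((nat -> nat) * (nat -> R))%type.

Definition plain (i : instr) : bool :=
  match i with JLt _ _ _ | JRLt _ _ _ | Halt => false | _ => true end.

Definition fact (ins : instr) (s : flat) : flat :=
  let (M, X) := s in
  match ins with
  | IConst i v => (updN M i v, X)
  | IAdd i j k => (updN M i (M j + M k), X)
  | ISub i j k => (updN M i (M j - M k), X)
  | IMul i j k => (updN M i (M j * M k), X)
  | ILoad i j => (updN M i (M (M j)), X)
  | IStore i j => (updN M (M i) (M j), X)
  | RConst i z => (M, updR X i (IZR z))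
  | RAdd i j k => (M, updR X i (X j + X k)%R)
  | RSub i j k => (M, updR X i (X j - X k)%R)
  | RMul i j k => (M, updR X i (X j * X k)%R)
  | RDiv i j k => (M, updR X i (X j / X k)%R)
  | RSqrt i j => (M, updR X i (sqrt (X j)))
  | RLoad i j => (M, updR X i (X (M j)))
  | RStore i j => (M, updR X (M i) (X j))
  | OfNat i j => (M, updR X i (INR (M j)))
  | _ => s
  end.

Definition fval (t : test) (s : flat) : bool :=
  match t with
  | TN j k => Nat.ltb (fst s j) (fst s k)
  | TR j k => if Rlt_dec (snd s j) (snd s k) then true else false
  end.

Definition fok (i : instr) (s : flat) : Prop := plain i = true.

Local Notation fexec := (exec fok fact fval).
Local Notation ftot := (tot fok fact fval).

Definition jmp (t : test) (a : nat) : instr :=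
  match t with TN j k => JLt j k a | TR j k => JRLt j k a end.

Fixpoint csize (c : cmd instr) : nat :=
  match c with
  | Blk l => length l
  | Seq c1 c2 => csize c1 + csize c2
  | If _ c => 2 + csize c
  | While _ c => 3 + csize c
  end.

(* Registers 2 and 3 hold 0 and 1, so that [JLt 2 3] is an unconditional jump. *)
Fixpoint compile (c : cmd instr) (a : nat) : list instr :=
  match c with
  | Blk l => l
  | Seq c1 c2 => compile c1 a ++ compile c2 (a + csize c1)
  | If t c => jmp t (a + 2) :: JLt 2 3 (a + 2 + csize c) :: compile c (a + 2)
  | While t c =>
      jmp t (a + 2) :: JLt 2 3 (a + 3 + csize c) :: compile c (a + 2) ++ [JLt 2 3 a]
  end.

(** [IStore] is rejected because its target is known only at run time. *)
Definition keeps23 (i : instr) : bool :=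
  match i with
  | IConst i _ | IAdd i _ _ | ISub i _ _ | IMul i _ _ | ILoad i _ =>
      negb (Nat.eqb i 2) && negb (Nat.eqb i 3)
  | IStore _ _ => false
  | _ => true
  end.

Fixpoint ckeeps23 (c : cmd instr) : bool :=
  match c with
  | Blk l => forallb keeps23 l
  | Seq c1 c2 => ckeeps23 c1 && ckeeps23 c2
  | If _ c | While _ c => ckeeps23 c
  end.

Definition code_at (prog : list instr) (a : nat) (l : list instr) : Prop :=
  forall i x, nth_error l i = Some x -> nth_error prog (a + i) = Some x.

Lemma compile_length c : forall a, length (compile c a) = csize c.
Proof.
  induction c; intros a; cbn; rewrite ?length_app, ?IHc, ?IHc1, ?IHc2; cbn; lia.
Qed.

Lemma code_at_cons prog a x l :
  code_at prog a (x :: l) -> nth_error prog a = Some x /\ code_at prog (S a) l.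
Proof.
  intros H. split.
  - specialize (H 0 x eq_refl). now rewrite Nat.add_0_r in H.
  - intros i y Hy. specialize (H (S i) y Hy). now rewrite Nat.add_succ_r in H.
Qed.

Lemma code_at_app prog a l1 l2 :
  code_at prog a (l1 ++ l2) -> code_at prog a l1 /\ code_at prog (a + length l1) l2.
Proof.
  intros H. split; intros i x Hx.
  - apply H. rewrite nth_error_app1; auto. apply nth_error_Some. congruence.
  - rewrite <- Nat.add_assoc. apply H. rewrite nth_error_app2 by lia.
    now replace (length l1 + i - length l1) with i by lia.
Qed.

Lemma run_add p t1 t2 c : run p (t1 + t2) c = run p t2 (run p t1 c).
Proof. unfold run. rewrite Nat.add_comm. apply Nat.iter_add. Qed.

Lemma run_S p t c : run p (S t) c = run p t (step p c).
Proof. exact (run_add p 1 t c). Qed.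

Definition at_pc (a : nat) (s : flat) : config := Config a (fst s) (snd s).

Definition flags (s : flat) : Prop := fst s 2 = 0 /\ fst s 3 = 1.

Lemma step_jmp p a t b s :
  nth_error p a = Some (jmp t b) ->
  step p (at_pc a s) = at_pc (if fval t s then b else S a) s.
Proof.
  intros H. destruct s as [M X]. unfold step, at_pc. cbn. rewrite H.
  destruct t; cbn; [reflexivity|]. now destruct (Rlt_dec _ _).
Qed.

Lemma step_goto p a b s :
  nth_error p a = Some (JLt 2 3 b) -> flags s -> step p (at_pc a s) = at_pc b s.
Proof.
  intros H [H2 H3]. rewrite (step_jmp p a (TN 2 3) b s H). cbn. now rewrite H2, H3.
Qed.

Lemma step_plain p a i s :
  nth_error p a = Some i -> plain i = true ->
  step p (at_pc a s) = at_pc (S a) (fact i s).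
Proof.
  intros H Hp. destruct s as [M X]. unfold step, at_pc. cbn. rewrite H.
  destruct i; try discriminate; reflexivity.
Qed.

Lemma fact_flags i s : keeps23 i = true -> flags s -> flags (fact i s).
Proof.
  intros Hk [H2 H3]. destruct s as [M X]. unfold flags in *. cbn in H2, H3.
  destruct i; cbn in *; unfold updN; try (split; assumption); try discriminate;
    apply andb_true_iff in Hk; destruct Hk as [Ha Hb];
    apply negb_true_iff in Ha, Hb; rewrite (Nat.eqb_sym 2), (Nat.eqb_sym 3), Ha, Hb;
    split; assumption.
Qed.

Lemma run_block l : forall p a s,
  code_at p a l -> oks fok fact l s -> forallb keeps23 l = true -> flags s ->
  run p (length l) (at_pc a s) = at_pc (a + length l) (acts fact l s) /\
  flags (acts fact l s).
Proof.
  induction l as [|i l IH]; intros p a s Hc Ho Hk Hf.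
  - cbn. now rewrite Nat.add_0_r.
  - apply code_at_cons in Hc as [Hi Hc]. destruct Ho as [Hp Ho].
    apply andb_true_iff in Hk as [Hki Hk]. cbn [length acts].
    rewrite run_S, (step_plain p a i s Hi Hp), Nat.add_succ_r.
    apply (IH p (S a)); auto. now apply fact_flags.
Qed.

(** Induction on the derivation rather than on the command: after one iteration a loop is run again
    as the same code at the same address. *)
Lemma compile_correct c s t s' :
  fexec c s t s' -> forall p a,
  code_at p a (compile c a) -> ckeeps23 c = true -> flags s ->
  run p t (at_pc a s) = at_pc (a + csize c) s' /\ flags s'.
Proof.
  induction 1 as [l s Ho | c1 c2 s s1 s2 t1 t2 _ IH1 _ IH2 | t c s s' n Hv _ IH
    | t c s Hv | t c s s1 s2 n1 n2 Hv _ IH1 _ IH2 | t c s Hv];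
    intros p a Hc Hk Hf; cbn [compile csize ckeeps23] in *.
  - now apply run_block.
  - apply code_at_app in Hc as [Hc1 Hc2]. rewrite compile_length in Hc2.
    apply andb_true_iff in Hk as [Hk1 Hk2].
    destruct (IH1 p a Hc1 Hk1 Hf) as [R1 F1].
    destruct (IH2 p _ Hc2 Hk2 F1) as [R2 F2].
    rewrite run_add, R1, R2, Nat.add_assoc. auto.
  - apply code_at_cons in Hc as [Hj Hc]. apply code_at_cons in Hc as [_ Hc].
    rewrite run_S, (step_jmp p a t (a + 2) s Hj), Hv.
    replace (S (S a)) with (a + 2) in Hc by lia.
    destruct (IH p _ Hc Hk Hf) as [R1 F1]. rewrite R1, Nat.add_assoc. auto.
  - apply code_at_cons in Hc as [Hj Hc]. apply code_at_cons in Hc as [Hg _].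
    rewrite run_S, (step_jmp p a t (a + 2) s Hj), Hv, run_S,
      (step_goto p _ _ s Hg Hf), Nat.add_assoc. auto.
  - destruct (code_at_cons _ _ _ _ Hc) as [Hj Hc'].
    apply code_at_cons in Hc' as [_ Hc']. apply code_at_app in Hc' as [Hc1 Hc2].
    apply code_at_cons in Hc2 as [Hg _]. rewrite compile_length in Hg.
    replace (S (S a)) with (a + 2) in * by lia.
    destruct (IH1 p _ Hc1 Hk Hf) as [R1 F1].
    destruct (IH2 p a Hc Hk F1) as [R2 F2].
    replace (n1 + n2 + 2) with (S (n1 + S n2)) by lia.
    rewrite run_S, (step_jmp p a t (a + 2) s Hj), Hv, run_add, R1, run_S.
    rewrite (step_goto p _ _ s1 Hg F1), R2. auto.
  - apply code_at_cons in Hc as [Hj Hc]. apply code_at_cons in Hc as [Hg _].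
    rewrite run_S, (step_jmp p a t (a + 2) s Hj), Hv, run_S,
      (step_goto p _ _ s Hg Hf), Nat.add_assoc. auto.
Qed.

(** * Programs over named arrays *)

Record st : Type := St { nv : nat -> nat; rv : nat -> R; av : nat -> nat -> R }.

Inductive aop : Type :=
| NCst (i c : nat)
| NPlus (i j k : nat)
| NTimes (i j k : nat)
| RCst (i : nat) (z : Z)
| RPlus (i j k : nat)
| RMinus (i j k : nat)
| RTimes (i j k : nat)
| RQuot (i j k : nat)
| RRoot (i j : nat)
| Ld (i a j : nat)
| Sto (a j i : nat).

Definition updA (A : nat -> nat -> R) (a : nat) (f : nat -> R) : nat -> nat -> R :=
  fun x => if Nat.eqb x a then f else A x.

Definition act (o : aop) (s : st) : st :=
  match o with
  | NCst i c => St (updN (nv s) i c) (rv s) (av s)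
  | NPlus i j k => St (updN (nv s) i (nv s j + nv s k)) (rv s) (av s)
  | NTimes i j k => St (updN (nv s) i (nv s j * nv s k)) (rv s) (av s)
  | RCst i z => St (nv s) (updR (rv s) i (IZR z)) (av s)
  | RPlus i j k => St (nv s) (updR (rv s) i (rv s j + rv s k)%R) (av s)
  | RMinus i j k => St (nv s) (updR (rv s) i (rv s j - rv s k)%R) (av s)
  | RTimes i j k => St (nv s) (updR (rv s) i (rv s j * rv s k)%R) (av s)
  | RQuot i j k => St (nv s) (updR (rv s) i (rv s j / rv s k)%R) (av s)
  | RRoot i j => St (nv s) (updR (rv s) i (sqrt (rv s j))) (av s)
  | Ld i a j => St (nv s) (updR (rv s) i (av s a (nv s j))) (av s)
  | Sto a j i => St (nv s) (rv s) (updA (av s) a (updR (av s a) (nv s j) (rv s i)))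
  end.

Definition aok (sz : nat -> nat) (o : aop) (s : st) : Prop :=
  match o with
  | Ld _ a j | Sto a j _ => nv s j < sz a
  | _ => True
  end.

Definition aval (t : test) (s : st) : bool :=
  match t with
  | TN j k => Nat.ltb (nv s j) (nv s k)
  | TR j k => if Rlt_dec (rv s j) (rv s k) then true else false
  end.

Definition nreg : nat := 8.

Definition wfop (o : aop) : bool :=
  match o with
  | RCst i _ => i <? nreg
  | RPlus i j k | RMinus i j k | RTimes i j k | RQuot i j k =>
      (i <? nreg) && (j <? nreg) && (k <? nreg)
  | RRoot i j => (i <? nreg) && (j <? nreg)
  | Ld i a _ | Sto a _ i => (i <? nreg) && (a <? 7)
  | _ => true
  end.

Definition wft (t : test) : bool :=
  match t with TN _ _ => true | TR j k => (j <? nreg) && (k <? nreg) end.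

Fixpoint wf (c : cmd aop) : bool :=
  match c with
  | Blk l => forallb wfop l
  | Seq c1 c2 => wf c1 && wf c2
  | If t c | While t c => wft t && wf c
  end.

(* Variable [i] lives in register [16 + i]; register [5 + a] holds the base
   address of array [a], and register 12 is used for address computations. *)
Definition trop (o : aop) : list instr :=
  match o with
  | NCst i c => [IConst (16 + i) c]
  | NPlus i j k => [IAdd (16 + i) (16 + j) (16 + k)]
  | NTimes i j k => [IMul (16 + i) (16 + j) (16 + k)]
  | RCst i z => [RConst i z]
  | RPlus i j k => [RAdd i j k]
  | RMinus i j k => [RSub i j k]
  | RTimes i j k => [RMul i j k]
  | RQuot i j k => [RDiv i j k]
  | RRoot i j => [RSqrt i j]
  | Ld i a j => [IAdd 12 (5 + a) (16 + j); RLoad i 12]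
  | Sto a j i => [IAdd 12 (5 + a) (16 + j); RStore 12 i]
  end.

Definition trt (t : test) : test :=
  match t with TN j k => TN (16 + j) (16 + k) | TR j k => TR j k end.

Fixpoint tr (c : cmd aop) : cmd instr :=
  match c with
  | Blk l => Blk (flat_map trop l)
  | Seq c1 c2 => Seq (tr c1) (tr c2)
  | If t c => If (trt t) (tr c)
  | While t c => While (trt t) (tr c)
  end.

Lemma updN_eq f a v : updN f a v a = v.
Proof. unfold updN. now rewrite Nat.eqb_refl. Qed.

Lemma updN_neq f a v x : x <> a -> updN f a v x = f x.
Proof. intros H. unfold updN. apply Nat.eqb_neq in H. now rewrite H. Qed.

Lemma updR_eq f a v : updR f a v a = v.
Proof. unfold updR. now rewrite Nat.eqb_refl. Qed.

Lemma updR_neq f a v x : x <> a -> updR f a v x = f x.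
Proof. intros H. unfold updR. apply Nat.eqb_neq in H. now rewrite H. Qed.

Lemma updA_eq A a f : updA A a f a = f.
Proof. unfold updA. now rewrite Nat.eqb_refl. Qed.

(** * Simulation of named arrays in the flat memory *)

Section Simulation.
Variables (sz : nat -> nat) (D : nat).
Hypothesis HD : nreg <= D.
Hypothesis Hsz : forall a, sz a <= D.

(** Every array owns a block of length [D]; the [+ 1] leaves the cells below [D] to the real
    registers. *)
Definition base (a : nat) : nat := D * (a + 1).

Lemma base_inj a b i j : i < D -> j < D -> base a + i = base b + j -> a = b /\ i = j.
Proof.
  unfold base. intros Hi Hj H.
  assert (a = b).
  { destruct (lt_eq_lt_dec a b) as [[?|?]|?]; auto; exfalso; nia. }
  subst. split; [reflexivity | lia].
Qed.

Lemma base_ge a : D <= base a.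
Proof. clear. unfold base. nia. Qed.

Record rel (s : st) (F : flat) : Prop := Rel {
  rel_nv : forall i, fst F (16 + i) = nv s i;
  rel_rv : forall i, i < nreg -> snd F i = rv s i;
  rel_av : forall a i, a < 7 -> i < sz a -> snd F (base a + i) = av s a i;
  rel_base : forall a, a < 7 -> fst F (5 + a) = base a;
  rel_flags : flags F }.

Lemma rel_updN s M X N V A i v w :
  s = St N V A -> rel s (M, X) -> v = w ->
  rel (St (updN N i v) V A) (updN M (16 + i) w, X).
Proof.
  intros -> [H1 H2 H3 H4 [H5 H6]] ->. split; auto.
  - intros j. cbn [nv fst]. destruct (Nat.eq_dec j i) as [->|Hn].
    + now rewrite !updN_eq.
    + rewrite !updN_neq by lia. apply H1.
  - intros a Ha. cbn [fst]. rewrite updN_neq by lia. now apply H4.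
  - split; cbn [fst]; rewrite updN_neq by lia; assumption.
Qed.

Lemma rel_updR s M X N V A i v w :
  s = St N V A -> rel s (M, X) -> i < nreg -> v = w ->
  rel (St N (updR V i v) A) (M, updR X i w).
Proof.
  intros -> [H1 H2 H3 H4 H5] Hi ->. split; auto.
  - intros j Hj. cbn [rv snd]. destruct (Nat.eq_dec j i) as [->|Hn].
    + now rewrite !updR_eq.
    + rewrite !updR_neq by lia. now apply H2.
  - intros a j Ha Hj. cbn [snd]. pose proof (base_ge a).
    rewrite updR_neq by lia. now apply H3.
Qed.

Lemma rel_tmp s M X v : rel s (M, X) -> rel s (updN M 12 v, X).
Proof.
  intros [H1 H2 H3 H4 [H5 H6]]. split; auto.
  - intros a Ha. cbn [fst]. rewrite updN_neq by lia. now apply H4.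
  - split; cbn [fst]; rewrite updN_neq by lia; assumption.
Qed.

Lemma rel_act o s F :
  aok sz o s -> wfop o = true -> rel s F ->
  oks fok fact (trop o) F /\ rel (act o s) (acts fact (trop o) F).
Proof.
  intros Ho Hw Hr. destruct F as [M X], s as [N V A].
  pose proof Hr as [H1 H2 H3 H4 H5]. cbn [nv rv av fst snd] in *.
  destruct o as [i c|i j k|i j k|i z|i j k|i j k|i j k|i j k|i j|i a j|a j i];
    cbn [wfop] in Hw;
    repeat (apply andb_true_iff in Hw; let H := fresh in destruct Hw as [Hw H]);
    repeat match goal with H : (_ <? _) = true |- _ => apply Nat.ltb_lt in H end;
    cbn [trop oks acts]; unfold fok; (split; [repeat split|]); cbn [fact act nv rv av].
  1-3: eapply rel_updN; eauto; now rewrite ?H1.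
  1-6: eapply rel_updR; eauto; now rewrite ?H2 by assumption.
  - cbn [aok nv] in Ho. rewrite (updN_eq M 12), H1, H4 by assumption.
    eapply rel_updR; eauto.
    + apply rel_tmp. eassumption.
    + symmetry. now apply H3.
  - cbn [aok nv] in Ho. rewrite (updN_eq M 12), H1, H4 by assumption.
    apply rel_tmp with (v := base a + N j) in Hr.
    destruct Hr as [G1 G2 G3 G4 G5]. pose proof (Hsz a).
    split; auto; cbn [fst snd rv av] in *.
    + intros x Hx. pose proof (base_ge a). rewrite updR_neq by lia. now apply H2.
    + intros b x Hb Hx. pose proof (Hsz b).
      (* Blocks are disjoint, so the written cell is seen only through array [a] at its own
         index. *)
      destruct (Nat.eq_dec (base b + x) (base a + N j)) as [E|E].
      * apply base_inj in E as [-> ->]; try lia.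
        rewrite updR_eq, updA_eq, updR_eq. now apply H2.
      * rewrite updR_neq by assumption. unfold updA.
        destruct (Nat.eqb_spec b a) as [->|_]; [|now apply H3].
        rewrite updR_neq by (intros ->; now apply E). now apply H3.
Qed.

Lemma oks_app l1 l2 F :
  oks fok fact (l1 ++ l2) F <-> oks fok fact l1 F /\ oks fok fact l2 (acts fact l1 F).
Proof.
  revert F. induction l1 as [|i l1 IH]; intros F; cbn; [tauto|].
  rewrite IH. tauto.
Qed.

Lemma acts_app l1 l2 F : acts fact (l1 ++ l2) F = acts fact l2 (acts fact l1 F).
Proof. revert F. induction l1 as [|i l1 IH]; intros F; cbn; auto. Qed.

Lemma rel_acts l : forall s F,
  oks (aok sz) act l s -> forallb wfop l = true -> rel s F ->
  oks fok fact (flat_map trop l) F /\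
  rel (acts act l s) (acts fact (flat_map trop l) F).
Proof.
  induction l as [|o l IH]; intros s F Ho Hw Hr; [now split|].
  destruct Ho as [Ho Ho']. apply andb_true_iff in Hw as [Hw Hw'].
  destruct (rel_act o s F Ho Hw Hr) as [G1 G2].
  destruct (IH _ _ Ho' Hw' G2) as [G3 G4].
  cbn [flat_map acts]. rewrite oks_app, acts_app. auto.
Qed.

Lemma trop_length l : length (flat_map trop l) <= 2 * length l.
Proof.
  induction l as [|o l IH]; cbn [flat_map length]; [lia|].
  rewrite length_app. destruct o; cbn [trop length]; lia.
Qed.

Lemma rel_val t s F : wft t = true -> rel s F -> fval (trt t) F = aval t s.
Proof.
  intros Hw [H1 H2 _ _ _]. destruct t as [j k|j k]; cbn [trt fval aval].
  - now rewrite !H1.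
  - apply andb_true_iff in Hw as [Hj Hk]. apply Nat.ltb_lt in Hj, Hk.
    now rewrite !H2.
Qed.

(** The factor 2 comes from array accesses, which become an address computation followed by the
    access; all other operations and all tests translate one to one. *)
Lemma exec_tr c s t s' : exec (aok sz) act aval c s t s' ->
  wf c = true -> forall F, rel s F ->
  exists t' F', fexec (tr c) F t' F' /\ rel s' F' /\ t' <= 2 * t.
Proof.
  induction 1 as [l s Ho | c1 c2 s s1 s2 t1 t2 _ IH1 _ IH2 | t c s s' n Hv _ IH
    | t c s Hv | t c s s1 s2 n1 n2 Hv _ IH1 _ IH2 | t c s Hv];
    intros Hw F Hr; cbn [wf tr] in *; try (apply andb_true_iff in Hw as [Hw1 Hw2]).
  - destruct (rel_acts l s F Ho Hw Hr) as [G1 G2].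
    do 2 eexists. split; [now constructor | split; [assumption | apply trop_length]].
  - destruct (IH1 Hw1 F Hr) as (n1 & F1 & E1 & R1 & T1).
    destruct (IH2 Hw2 F1 R1) as (n2 & F2 & E2 & R2 & T2).
    do 2 eexists. split; [econstructor; eassumption | split; [assumption | lia]].
  - destruct (IH Hw2 F Hr) as (n1 & F1 & E1 & R1 & T1).
    do 2 eexists. split; [apply ex_if_true; [|eassumption] | split; [assumption | lia]].
    now rewrite (rel_val t s).
  - do 2 eexists. split; [apply ex_if_false | split; [eassumption | lia]].
    now rewrite (rel_val t s).
  - destruct (IH1 Hw2 F Hr) as (m1 & F1 & E1 & R1 & T1).
    destruct (IH2 ltac:(cbn [wf]; now rewrite Hw1, Hw2) F1 R1) as (m2 & F2 & E2 & R2 & T2).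
    do 2 eexists. split; [eapply ex_while_true; try eassumption | split; [eassumption | lia]].
    now rewrite (rel_val t s).
  - do 2 eexists. split; [apply ex_while_false | split; [eassumption | lia]].
    now rewrite (rel_val t s).
Qed.

End Simulation.

(** * Moving the input and the output between their prescribed cells and the arrays *)

Lemma oks_plain l : forallb plain l = true -> forall F, oks fok fact l F.
Proof.
  induction l as [|i l IH]; cbn; auto. intros H F.
  apply andb_true_iff in H as [H1 H2]. split; auto.
Qed.

(** The input starts at cell 0, where the real registers live. These cells are copied by
    straight-line code that overwrites no real register, before the copying loop uses register 0 as
    scratch. *)
Definition save_regs (l : list nat) : list instr :=
  flat_map (fun j => [IConst 12 j; IAdd 12 12 5; RStore 12 j]) l.

Lemma save_regs_spec D l : forall M X,
  M 5 = D -> (forall j, In j l -> j < D) ->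
  let F := acts fact (save_regs l) (M, X) in
  (forall r, r <> 12 -> fst F r = M r) /\
  (forall a, In a l -> snd F (D + a) = X a) /\
  (forall a, (forall j, In j l -> a <> D + j) -> snd F a = X a).
Proof.
  induction l as [|j l IH]; intros M X HM Hl; cbn -[Nat.add].
  - repeat split; auto. intros a [].
  -
    destruct (IH (updN (updN M 12 j) 12 (j + M 5)) (updR X (j + M 5) (X j)))
      as (H1 & H2 & H3).
    { now rewrite !updN_neq by lia. }
    { intros i Hi. apply Hl. now right. }
    pose proof (Hl j (or_introl eq_refl)).
    split; [|split].
    + intros r Hr. rewrite H1 by assumption. now rewrite !updN_neq by assumption.
    + intros a Ha. destruct (in_dec Nat.eq_dec a l) as [Hi|Hi].
      * rewrite H2 by assumption. apply updR_neq. specialize (Hl a Ha). lia.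
      * destruct Ha as [<-|Ha]; [|contradiction].
        rewrite H3, HM; [now rewrite Nat.add_comm, updR_eq|].
        intros i Hin E. assert (j = i) by lia. now subst.
    + intros a Ha. rewrite H3; [apply updR_neq|].
      * rewrite HM, Nat.add_comm. apply Ha. now left.
      * intros i Hi. apply Ha. now right.
Qed.

Definition load_regs (l : list nat) : list instr :=
  flat_map (fun j => [IConst 12 j; IAdd 12 11 12; RLoad j 12]) l.

Lemma load_regs_spec B l : forall M X,
  M 11 = B -> (forall j, In j l -> j < B) ->
  let F := acts fact (load_regs l) (M, X) in
  (forall r, r <> 12 -> fst F r = M r) /\
  (forall a, In a l -> snd F a = X (B + a)) /\
  (forall a, ~ In a l -> snd F a = X a).
Proof.
  induction l as [|j l IH]; intros M X HM Hl; cbn -[Nat.add].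
  - repeat split; auto. intros a [].
  - rewrite HM.
    destruct (IH (updN (updN M 12 j) 12 (B + j)) (updR X j (X (B + j))))
      as (H1 & H2 & H3).
    { now rewrite !updN_neq by lia. }
    { intros i Hi. apply Hl. now right. }
    pose proof (Hl j (or_introl eq_refl)).
    split; [|split].
    + intros r Hr. rewrite H1 by assumption. now rewrite !updN_neq by assumption.
    + intros a Ha. destruct (in_dec Nat.eq_dec a l) as [Hi|Hi].
      * rewrite H2 by assumption. apply updR_neq. lia.
      * destruct Ha as [<-|Ha]; [|contradiction].
        rewrite H3 by assumption. apply updR_eq.
    + intros a Ha. rewrite H3 by (intros Hi; apply Ha; now right).
      apply updR_neq. intros ->. apply Ha. now left.
Qed.

Definition sizes (d n a : nat) : nat :=
  match a with 0 => n * d | 6 => n * (d + 1) | _ => n end.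

(** Register 5 receives [D = n d + n + nreg], an upper bound for all array sizes and for the number
    of real registers; adding it repeatedly yields the multiples [base D a]. *)
Definition prologue (d : nat) : cmd instr :=
  Blk ([IConst 4 d; IMul 14 0 4; IAdd 5 14 0; IConst 13 nreg;
        IAdd 5 5 13; IAdd 6 5 5; IAdd 7 6 5; IAdd 8 7 5; IAdd 9 8 5; IAdd 10 9 5;
        IAdd 11 10 5; IAdd 16 0 2; IAdd 17 1 2] ++ save_regs (seq 0 nreg)) ;;
  While (TN 13 14)
    (Blk [RLoad 0 13; IAdd 12 5 13; RStore 12 0; IAdd 13 13 3]).

(** The order of the prologue is reversed: the cells below [nreg] are filled last, because the loop
    uses cell 0 as scratch. *)
Definition epilogue (d : nat) : cmd instr :=
  Blk [IAdd 0 21 2; IConst 4 (d + 1); IMul 14 0 4; IConst 13 nreg] ;;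
  While (TN 13 14)
    (Blk [IAdd 12 11 13; RLoad 0 12; RStore 13 0; IAdd 13 13 3]) ;;
  Blk (load_regs (seq 0 nreg)).

Lemma prologue_spec d n k Spts :
  let c0 := init_config d n k Spts in
  let D := n * d + n + nreg in
  ftot (prologue d) (updN (imem c0) 3 1, rmem c0) (60 + 8 * (n * d)) (fun F =>
    fst F 2 = 0 /\ fst F 3 = 1 /\ fst F 16 = n /\ fst F 17 = k /\
    (forall a, a < 7 -> fst F (5 + a) = base D a) /\
    (forall a, a < n * d -> snd F (base D 0 + a) = rmem c0 a)).
Proof.
  intros c0 D. set (X0 := rmem c0).
  assert (HD : D = n * d + n + nreg) by reflexivity. clearbody D.
  apply (tot_seq _ _ _ _ _ _ _ _ 40 (20 + 8 * (n * d))); [|lia].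
  apply tot_blk; [now apply oks_plain | cbn; lia |].
  rewrite acts_app.
  match goal with |- context [acts fact (save_regs _) ?s] => set (F0 := s) end.
  assert (E0 : (forall a, a < 7 -> fst F0 (5 + a) = base D a) /\
    fst F0 2 = 0 /\ fst F0 3 = 1 /\ fst F0 16 = n /\ fst F0 17 = k /\
    fst F0 13 = nreg /\ fst F0 14 = n * d /\ snd F0 = X0).
  { cbn [acts fact F0 fst snd c0 init_config imem rmem updN Nat.eqb X0].
    repeat split; try lia. unfold base. rewrite HD.
    intros a Ha. do 7 (destruct a as [|a]; [cbn [Nat.add Nat.eqb updN]; lia|]). lia. }
  clearbody F0. destruct F0 as [M X]. cbn [fst snd] in E0.
  destruct E0 as (Hb & H2 & H3 & H16 & H17 & H13 & H14 & ->).
  assert (H5 : M 5 = D) by (change (M (5 + 0) = D); rewrite Hb by lia; unfold base; lia).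
  destruct (save_regs_spec D (seq 0 nreg) M X0 H5) as (G1 & G2 & G3).
  { intros j Hj. apply in_seq in Hj. lia. }
  destruct (acts fact (save_regs (seq 0 nreg)) (M, X0)) as [M1 X1].
  cbn [fst snd] in G1, G2, G3.
  apply (tot_while _ _ _ _ _
    (fun F => (forall a, a < 7 -> fst F (5 + a) = base D a) /\
      fst F 2 = 0 /\ fst F 3 = 1 /\ fst F 16 = n /\ fst F 17 = k /\
      fst F 14 = n * d /\ nreg <= fst F 13 /\
      (forall a, a < n * d -> nreg <= a -> snd F a = X0 a) /\
      (forall a, a < n * d -> a < fst F 13 -> snd F (D + a) = X0 a))
    (fun F => 6 * (n * d - fst F 13))).
  - intros [M' X'] (I1 & I2 & I3 & I4 & I5 & I6 & I7 & I8 & I9) Hv.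
    cbn [fst snd fval] in *. apply Nat.ltb_lt in Hv.
    assert (I5' : M' 5 = D) by (change (M' (5 + 0) = D); rewrite I1 by lia; unfold base; lia).
    assert (nreg = 8) by reflexivity.
    exists 4. apply tot_blk; [now apply oks_plain | cbn; lia |].
    cbn [acts fact fst snd]. rewrite (updN_eq M' 12), !I5', !(updN_neq _ 12), (updR_eq _ 0), !I3 by lia.
    repeat split; rewrite ?updN_eq, ?updN_neq by lia; auto; try lia.
    + intros a Ha. rewrite !updN_neq by lia. auto.
    + intros a Ha Hg. rewrite !updR_neq by lia. auto.
    + intros a Ha Hg. destruct (Nat.eq_dec a (M' 13)) as [->|Hn].
      * rewrite updR_eq. apply I8; lia.
      * rewrite !updR_neq by lia. apply I9; lia.
  - intros [M' X'] (I1 & I2 & I3 & I4 & I5 & I6 & I7 & I8 & I9) Hv.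
    cbn [fst snd fval] in *. apply Nat.ltb_ge in Hv. repeat split; auto.
    intros a Ha. replace (base D 0) with D by (unfold base; lia). apply I9; lia.
  - cbn [fst snd]. rewrite !G1 by lia. repeat split; auto; try lia.
    + intros a Ha. rewrite G1 by lia. auto.
    + intros a Ha Hg. apply G3. intros j Hj. apply in_seq in Hj. lia.
    + intros a Ha Hg. apply G2. apply in_seq. lia.
  - cbn [fst]. lia.
Qed.

Lemma epilogue_spec d n D m F :
  fst F 2 = 0 -> fst F 3 = 1 -> fst F 21 = m -> fst F 11 = base D 6 ->
  nreg <= D -> n * (d + 1) <= D -> m <= n ->
  ftot (epilogue d) F (60 + 8 * (n * (d + 1))) (fun F' =>
    fst F' 0 = m /\
    (forall a, a < m * (d + 1) -> snd F' a = snd F (base D 6 + a))).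
Proof.
  intros H2 H3 H21 H11 HD HD' Hm. destruct F as [M X]. cbn [fst snd] in *.
  assert (HB : D <= base D 6) by apply base_ge. set (B := base D 6) in *. clearbody B.
  assert (Hmn : m * (d + 1) <= n * (d + 1)) by nia.
  assert (Hr8 : nreg = 8) by reflexivity.
  apply (tot_seq _ _ _ _ _ _ _ _ 4 (50 + 8 * (n * (d + 1)))); [|lia].
  apply tot_blk; [now apply oks_plain | cbn; lia |].
  apply (tot_seq _ _ _ _ _ _ _ _ (6 * (m * (d + 1)) + 2) 40); [|lia].
  (* The source is never overwritten: targets lie below [n * (d + 1) <= D], and the source starts at
     [B >= D]. *)
  apply (tot_while _ _ _ _ _
    (fun F => fst F 0 = m /\ fst F 3 = 1 /\ fst F 11 = B /\
      fst F 14 = m * (d + 1) /\ nreg <= fst F 13 /\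
      (forall a, a < D -> snd F (B + a) = X (B + a)) /\
      (forall a, nreg <= a -> a < fst F 13 -> snd F a = X (B + a)))
    (fun F => 6 * (m * (d + 1) - fst F 13))).
  - intros [M' X'] (I1 & I2 & I3 & I4 & I5 & I6 & I7) Hv.
    cbn [fst snd fval] in *. apply Nat.ltb_lt in Hv.
    exists 4. apply tot_blk; [now apply oks_plain | cbn; lia |].
    cbn [acts fact fst snd].
    rewrite (updN_eq M' 12), !I3, !(updN_neq _ 12), (updR_eq _ 0), !I2 by lia.
    repeat split; rewrite ?updN_eq, ?updN_neq by lia; auto; try lia.
    + intros a Ha. rewrite !updR_neq by lia. auto.
    + intros a Ha Hg. destruct (Nat.eq_dec a (M' 13)) as [->|Hn].
      * rewrite updR_eq. apply I6. lia.
      * rewrite !updR_neq by lia. apply I7; lia.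
  - intros [M' X'] (I1 & I2 & I3 & I4 & I5 & I6 & I7) Hv.
    cbn [fst snd fval] in *. apply Nat.ltb_ge in Hv.
    apply tot_blk; [now apply oks_plain | cbn; lia |].
    destruct (load_regs_spec B (seq 0 nreg) M' X' I3) as (G1 & G2 & G3).
    { intros j Hj. apply in_seq in Hj. lia. }
    split; [now rewrite G1 by lia|]. intros a Ha.
    destruct (le_lt_dec nreg a) as [Hn|Hn].
    + rewrite G3 by (rewrite in_seq; lia). apply I7; lia.
    + rewrite G2 by (rewrite in_seq; lia). apply I6. lia.
  - cbn [acts fact fst snd updN Nat.eqb]. repeat split; auto; try lia.
  - cbn [acts fact fst snd updN Nat.eqb]. lia.
Qed.

(* Arrays 0 and 6 are the input and the output, variables 0, 1 and 5 are
   [n], [k] and the number of balls. *)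
Definition assemble (d : nat) (c : cmd aop) : cmd instr :=
  prologue d ;; tr c ;; epilogue d.

Lemma keeps23_trop o : forallb keeps23 (trop o) = true.
Proof. now destruct o. Qed.

Lemma ckeeps23_tr c : ckeeps23 (tr c) = true.
Proof.
  induction c as [l|c1 IH1 c2 IH2|t c IH|t c IH]; cbn; auto.
  - induction l as [|o l IH]; cbn; auto. now rewrite forallb_app, IH, keeps23_trop.
  - now rewrite IH1, IH2.
Qed.

(** The interface between the verified program and the machine. [c] must work from arbitrary
    contents of all variables and arrays other than [n], [k] and the points; the terms beside
    [2 * T] pay for the two copying phases. *)
Theorem assemble_run d c n k Spts T (Q : st -> Prop) :
  wf c = true ->
  (forall s, nv s 0 = n -> nv s 1 = k ->
    (forall a, a < n * d -> av s 0 a = Spts (a / d) (a mod d)) ->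
    tot (aok (sizes d n)) act aval c s T (fun s' => Q s' /\ nv s' 5 <= n)) ->
  exists t, t <= 2 * T + 130 + 16 * (n * (d + 1)) /\
  let prog := IConst 3 1 :: compile (assemble d c) 1 in
  let cf := run prog t (init_config d n k Spts) in
  halted prog cf /\
  exists s', Q s' /\ out_count cf = nv s' 5 /\
    forall a, a < nv s' 5 * (d + 1) -> rmem cf a = av s' 6 a.
Proof.
  intros Hwf Hc. set (D := n * d + n + nreg).
  set (c0 := init_config d n k Spts).
  destruct (prologue_spec d n k Spts)
    as (t1 & F1 & E1 & T1 & P2 & P3 & P16 & P17 & Pb & Pa).
  fold c0 in E1, Pa. fold D in Pb, Pa.
  (* The named state is read off the memory that the prologue leaves, so [rel] holds by
     construction. *)
  set (s1 := St (fun i => fst F1 (16 + i)) (snd F1) (fun a i => snd F1 (base D a + i))).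
  assert (HszD : forall a, sizes d n a <= D).
  { intros a. unfold D. do 7 (destruct a as [|a]; [cbn [sizes]; lia|]). cbn [sizes]. lia. }
  assert (R1 : rel (sizes d n) D s1 F1).
  { split; auto. now split. }
  destruct (Hc s1) as (t2 & s2 & E2 & T2 & HQ & Hm); auto.
  { intros a Ha. cbn [s1 av]. rewrite Pa by assumption. cbn [c0 init_config rmem].
    apply Nat.ltb_lt in Ha. now rewrite Ha. }
  destruct (exec_tr (sizes d n) D ltac:(unfold D; lia) HszD c s1 t2 s2 E2 Hwf F1 R1)
    as (t2' & F2 & E2' & R2 & T2').
  destruct R2 as [A1 A2 A3 A4 [A5 A6]].
  destruct (epilogue_spec d n D (nv s2 5) F2 A5 A6 (A1 5) (A4 6 ltac:(lia))
    ltac:(unfold D; lia) ltac:(unfold D; lia) Hm)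
    as (t3 & F3 & E3 & T3 & B0 & B1).
  exists (S (t1 + (t2' + t3))). split; [lia|]. intros prog cf.
  assert (Hrun : cf = at_pc (1 + csize (assemble d c)) F3).
  { unfold cf. rewrite run_S.
    apply (compile_correct (assemble d c) (updN (imem c0) 3 1, rmem c0) _ F3).
    - repeat (econstructor; try eassumption).
    - intros i x Hx. exact Hx.
    - cbn. now rewrite ckeeps23_tr.
    - now split. }
  rewrite Hrun. split.
  (* The machine stops by running past the last instruction. *)
  - unfold halted. cbn [at_pc pc].
    assert (L : length prog <= 1 + csize (assemble d c))
      by (unfold prog; cbn [length]; rewrite compile_length; lia).
    apply nth_error_None in L. cbn [at_pc pc]. now rewrite L.
  - exists s2. split; [assumption|]. split; [exact B0|].
    intros a Ha. cbn [at_pc rmem]. rewrite B1 by assumption.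
    apply A3; [lia|]. cbn [sizes]. nia.
Qed.

(** * Frames and loop rules *)

Arguments updN f a v x /.
Arguments updR f a v x /.
Arguments updA A a f x /.

Definition memb (x : nat) (l : list nat) : bool := existsb (Nat.eqb x) l.

Definition ntgt (o : aop) : list nat :=
  match o with NCst i _ | NPlus i _ _ | NTimes i _ _ => [i] | _ => [] end.

Definition rtgt (o : aop) : list nat :=
  match o with
  | RCst i _ | RPlus i _ _ | RMinus i _ _ | RTimes i _ _ | RQuot i _ _
  | RRoot i _ | Ld i _ _ => [i]
  | _ => []
  end.

Definition atgt (o : aop) : list nat := match o with Sto a _ _ => [a] | _ => [] end.

Fixpoint mods (tgt : aop -> list nat) (c : cmd aop) : list nat :=
  match c with
  | Blk l => flat_map tgt l
  | Seq c1 c2 => mods tgt c1 ++ mods tgt c2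
  | If _ c | While _ c => mods tgt c
  end.

(** The assigned names are computed from the syntax, so a closed program's frame conditions hold by
    evaluation; [frame] discharges them with [eq_refl]. *)
Definition framed (c : cmd aop) (s s' : st) : Prop :=
  (forall r, memb r (mods ntgt c) = false -> nv s' r = nv s r) /\
  (forall r, memb r (mods rtgt c) = false -> rv s' r = rv s r) /\
  (forall a, memb a (mods atgt c) = false -> av s' a = av s a).

Lemma framed_refl c s : framed c s s.
Proof. repeat split. Qed.

Lemma framed_trans c s1 s2 s3 : framed c s1 s2 -> framed c s2 s3 -> framed c s1 s3.
Proof.
  intros (A1 & A2 & A3) (B1 & B2 & B3).
  repeat split; intros r Hr; [rewrite B1, A1 | rewrite B2, A2 | rewrite B3, A3]; auto.
Qed.

Lemma framed_sub c c' s s' :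
  (forall tgt r, memb r (mods tgt c') = false -> memb r (mods tgt c) = false) ->
  framed c s s' -> framed c' s s'.
Proof. intros H (A1 & A2 & A3). repeat split; auto. Qed.

Lemma memb_app r l1 l2 : memb r (l1 ++ l2) = memb r l1 || memb r l2.
Proof. apply existsb_app. Qed.

Lemma act_framed o s :
  (forall r, memb r (ntgt o) = false -> nv (act o s) r = nv s r) /\
  (forall r, memb r (rtgt o) = false -> rv (act o s) r = rv s r) /\
  (forall a, memb a (atgt o) = false -> av (act o s) a = av s a).
Proof.
  destruct o; cbn; (repeat split; auto); intros r Hr; rewrite orb_false_r in Hr;
    now rewrite Hr.
Qed.

Lemma acts_framed l : forall s, framed (Blk l) s (acts act l s).
Proof.
  induction l as [|o l IH]; intros s; [apply framed_refl|].
  destruct (IH (act o s)) as (A1 & A2 & A3). destruct (act_framed o s) as (B1 & B2 & B3).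
  unfold framed. cbn [mods flat_map acts] in *.
  repeat split; intros r Hr; rewrite memb_app in Hr; apply orb_false_iff in Hr as [H1 H2];
    [rewrite A1, B1 | rewrite A2, B2 | rewrite A3, B3]; auto.
Qed.

Section Rules.
Variable sz : nat -> nat.
Notation aexec := (exec (aok sz) act aval).
Notation atot := (tot (aok sz) act aval).

Lemma exec_framed c s t s' : aexec c s t s' -> framed c s s'.
Proof.
  induction 1 as [l s Ho | c1 c2 s s1 s2 t1 t2 _ IH1 _ IH2 | t c s s' n Hv _ IH
    | t c s Hv | t c s s1 s2 n1 n2 Hv _ IH1 _ IH2 | t c s Hv];
    try apply framed_refl; auto.
  - apply acts_framed.
  - apply framed_trans with s1; [apply framed_sub with c1 | apply framed_sub with c2]; auto;
      intros tgt r; cbn [mods]; rewrite memb_app; intros H; now apply orb_false_iff in H.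
  - apply framed_trans with s1; auto.
Qed.

Lemma tot_framed c s T (Q : st -> Prop) :
  atot c s T (fun s' => framed c s s' -> Q s') -> atot c s T Q.
Proof.
  intros (t & s' & He & Ht & HQ). exists t, s'. repeat split; auto.
  apply HQ. eapply exec_framed; eauto.
Qed.

Lemma tot_then c1 c2 s T1 T2 T (Q1 Q : st -> Prop) :
  atot c1 s T1 Q1 ->
  (forall s1, framed c1 s s1 -> Q1 s1 -> atot c2 s1 T2 Q) ->
  T1 + T2 <= T -> atot (c1 ;; c2) s T Q.
Proof.
  intros H1 H2 HT. apply tot_seq with T1 T2; [|assumption].
  apply tot_framed. eapply tot_weaken; [exact H1 | lia | auto].
Qed.

Lemma tot_blk_then l c s T2 T (Q : st -> Prop) :
  oks (aok sz) act l s -> atot c (acts act l s) T2 Q -> length l + T2 <= T ->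
  atot (Blk l ;; c) s T Q.
Proof.
  intros Ho Hc HT. apply tot_seq with (length l) T2; [|assumption].
  now apply tot_blk.
Qed.

Lemma tot_loop s0 (Inv : st -> Prop) (Phi : st -> nat) t c (Q : st -> Prop) T :
  Inv s0 -> Phi s0 + 2 <= T ->
  (forall s, framed c s0 s -> Inv s -> aval t s = true ->
     exists T, atot c s T (fun s' => Inv s' /\ Phi s' + T + 2 <= Phi s)) ->
  (forall s, framed c s0 s -> Inv s -> aval t s = false -> Q s) ->
  atot (While t c) s0 T Q.
Proof.
  intros Hi HT Hb Hq.
  apply (tot_while _ _ _ _ _ (fun s => framed c s0 s /\ Inv s) Phi); auto.
  - intros s [Hf Hs] Hv. destruct (Hb s Hf Hs Hv) as [T' H]. exists T'.
    apply tot_framed. eapply tot_weaken; [exact H | lia |].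
    intros s' [H1 H2] Hf'. repeat split; auto; now apply (framed_trans c s0 s s').
  - intros s [Hf Hs] Hv. auto.
  - split; [apply framed_refl | assumption].
Qed.

Definition for_ (i b : nat) (body : cmd aop) : cmd aop :=
  While (TN i b) (body ;; Blk [NPlus i i 3]).

Definition setn (i v : nat) (s : st) : st := St (updN (nv s) i v) (rv s) (av s).

(** The body must establish the invariant for the state after the increment, hence [setn i (S m)].
    The 3 counts the increment and the two jumps of an iteration. *)
Lemma tot_for s0 i b body (Inv : nat -> st -> Prop) a N c (Q : st -> Prop) T :
  memb b (mods ntgt (for_ i b body)) = false ->
  memb 3 (mods ntgt (for_ i b body)) = false ->
  memb i (mods ntgt body) = false ->
  nv s0 i = a -> nv s0 b = N -> nv s0 3 = 1 -> a <= N ->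
  Inv a s0 -> (N - a) * (c + 3) + 2 <= T ->
  (forall m s, a <= m < N -> framed (for_ i b body) s0 s -> nv s i = m -> Inv m s ->
     atot body s c (fun s' => Inv (S m) (setn i (S m) s'))) ->
  (forall s, framed (for_ i b body) s0 s -> nv s i = N -> Inv N s -> Q s) ->
  atot (for_ i b body) s0 T Q.
Proof.
  intros Hb H3 Hi Ea EN E3 HaN HI HT Hbody HQ.
  apply (tot_loop s0 (fun s => a <= nv s i <= N /\ Inv (nv s i) s)
    (fun s => (N - nv s i) * (c + 3))).
  - rewrite Ea. auto.
  - now rewrite Ea.
  - intros s Hf [Hr Hs] Hv. cbn [aval] in Hv. apply Nat.ltb_lt in Hv.
    rewrite (proj1 Hf b Hb), EN in Hv.
    exists (c + 1). eapply (tot_then body _ s c 1).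
    + apply (Hbody (nv s i) s); auto; lia.
    + intros s1 Hf1 Hs1. pose proof (proj1 Hf1 i Hi) as Ei.
      assert (E31 : nv s1 3 = 1).
      { rewrite (proj1 Hf1), (proj1 Hf) ; auto.
        cbn [for_ mods] in H3. rewrite memb_app in H3. now apply orb_false_iff in H3. }
      apply tot_blk; [now split | cbn; lia |].
      cbn [acts act]. rewrite Ei, E31, Nat.add_1_r. unfold setn in Hs1.
      cbn [nv updN]. rewrite Nat.eqb_refl. split; [split; [lia | exact Hs1]|].
      replace (N - nv s i) with (S (N - S (nv s i))) by lia. lia.
    + lia.
  - intros s Hf [Hr Hs] Hv. cbn [aval] in Hv. apply Nat.ltb_ge in Hv.
    rewrite (proj1 Hf b Hb), EN in Hv. assert (E : nv s i = N) by lia.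
    rewrite E in Hs. auto.
Qed.

End Rules.

Ltac frame :=
  repeat match goal with
  | F : framed _ _ ?s |- context [nv ?s ?r] => rewrite (proj1 F r eq_refl)
  | F : framed _ _ ?s |- context [rv ?s ?r] => rewrite (proj1 (proj2 F) r eq_refl)
  | F : framed _ _ ?s |- context [av ?s ?r] => rewrite (proj2 (proj2 F) r eq_refl)
  end.

Ltac framein H :=
  repeat match type of H with
  | context [nv ?s ?r] =>
      match goal with F : framed _ _ s |- _ => rewrite (proj1 F r eq_refl) in H end
  | context [rv ?s ?r] =>
      match goal with F : framed _ _ s |- _ => rewrite (proj1 (proj2 F) r eq_refl) in H end
  | context [av ?s ?r] =>
      match goal with F : framed _ _ s |- _ => rewrite (proj2 (proj2 F) r eq_refl) in H end
  end.

Ltac ev := cbn [oks acts act aok aval setn nv rv av updN updR updA Nat.eqb length].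
Ltac evin H :=
  cbn [oks acts act aok aval setn nv rv av updN updR updA Nat.eqb length] in H.

(** * Counting *)

Definition b2n (b : bool) : nat := if b then 1 else 0.

Fixpoint cb (g : nat -> bool) (a len : nat) : nat :=
  match len with 0 => 0 | S l => cb g a l + b2n (g (a + l)) end.

Definition cnt (P : R -> bool) (f : nat -> R) (a len : nat) : nat :=
  cb (fun i => P (f i)) a len.

Definition below (v x : R) : bool := if Rlt_dec x v then true else false.
Definition upto (v x : R) : bool := if Rle_dec x v then true else false.

(** Ranks are expressed by counts of downward closed predicates: [below v] and [upto v] give the
    strict and the weak rank of [v], and the constant [true] gives the length, so one statement for
    all such [P] controls all three. *)
Definition down (P : R -> bool) : Prop :=
  forall x y, (x <= y)%R -> P y = true -> P x = true.

Lemma below_true v x : below v x = true <-> (x < v)%R.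
Proof. unfold below. destruct (Rlt_dec x v); split; auto; discriminate. Qed.

Lemma upto_true v x : upto v x = true <-> (x <= v)%R.
Proof. unfold upto. destruct (Rle_dec x v); split; auto; discriminate. Qed.

Lemma down_below v : down (below v).
Proof. intros x y H. rewrite !below_true. lra. Qed.

Lemma down_upto v : down (upto v).
Proof. intros x y H. rewrite !upto_true. lra. Qed.

Lemma down_true : down (fun _ => true).
Proof. easy. Qed.

Lemma b2n_le b : b2n b <= 1.
Proof. destruct b; cbn; lia. Qed.

Lemma cb_ext g h a len :
  (forall i, a <= i < a + len -> g i = h i) -> cb g a len = cb h a len.
Proof.
  induction len as [|l IH]; cbn; intros H; auto.
  rewrite IH, H by (intros; try apply H; lia). reflexivity.
Qed.

Lemma cb_le g h a len :
  (forall i, a <= i < a + len -> g i = true -> h i = true) -> cb g a len <= cb h a len.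
Proof.
  induction len as [|l IH]; cbn; intros H; auto.
  assert (cb g a l <= cb h a l) by (apply IH; intros; apply H; auto; lia).
  specialize (H (a + l) ltac:(lia)).
  destruct (g (a + l)); [rewrite H by auto | pose proof (b2n_le (h (a + l)))]; cbn; lia.
Qed.

Lemma cb_app g a l1 l2 : cb g a (l1 + l2) = cb g a l1 + cb g (a + l1) l2.
Proof.
  induction l2 as [|l IH]; cbn; [now rewrite Nat.add_0_r|].
  rewrite Nat.add_succ_r. cbn. rewrite IH, Nat.add_assoc. lia.
Qed.

Lemma cb_true g a len : (forall i, a <= i < a + len -> g i = true) -> cb g a len = len.
Proof.
  induction len as [|l IH]; cbn; intros H; auto.
  rewrite IH by (intros; apply H; lia). rewrite H by lia. cbn. lia.
Qed.

Lemma cb_false g a len : (forall i, a <= i < a + len -> g i = false) -> cb g a len = 0.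
Proof.
  induction len as [|l IH]; cbn; intros H; auto.
  rewrite IH by (intros; apply H; lia). rewrite H by lia. reflexivity.
Qed.

Lemma cb_bound g a len : cb g a len <= len.
Proof. induction len as [|l IH]; cbn; auto. pose proof (b2n_le (g (a + l))). lia. Qed.

Lemma cb_split g h a len :
  cb g a len = cb (fun i => g i && h i) a len + cb (fun i => g i && negb (h i)) a len.
Proof.
  induction len as [|l IH]; cbn; auto.
  rewrite IH. destruct (g (a + l)), (h (a + l)); cbn; lia.
Qed.

Lemma cb_upd g a len i b : a <= i < a + len ->
  cb (fun x => if Nat.eqb x i then b else g x) a len + b2n (g i) = cb g a len + b2n b.
Proof.
  induction len as [|l IH]; intros H; [lia|]. cbn.
  destruct (Nat.eqb_spec (a + l) i) as [<-|Hn].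
  - rewrite (cb_ext _ g a l); [lia|].
    intros x Hx. destruct (Nat.eqb_spec x (a + l)); [lia | auto].
  - specialize (IH ltac:(lia)). lia.
Qed.

Lemma cb_exists g a len : 0 < cb g a len -> exists i, a <= i < a + len /\ g i = true.
Proof.
  induction len as [|l IH]; cbn; [lia|]. intros H. destruct (g (a + l)) eqn:E.
  - exists (a + l). split; [lia | auto].
  - cbn in H. destruct IH as (i & Hi & Hg); [lia|]. exists i. split; [lia | auto].
Qed.

Lemma cb_pos g a len i : a <= i < a + len -> g i = true -> 0 < cb g a len.
Proof.
  induction len as [|l IH]; intros Hi Hg; cbn; [lia|].
  destruct (Nat.eq_dec i (a + l)) as [->|Hn]; [rewrite Hg; cbn; lia|].
  specialize (IH ltac:(lia) Hg). lia.
Qed.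

(** * Sorting a segment *)

(** A permutation matters only through counts, so equality of the counts of all predicates serves as
    its definition. *)
Definition rearr (a b : nat) (f f' : nat -> R) : Prop :=
  (forall P, cnt P f' a (b - a) = cnt P f a (b - a)) /\
  (forall i, ~ (a <= i < b) -> f' i = f i).

Definition sorted (f : nat -> R) (a b : nat) : Prop :=
  forall u v, a <= u -> u <= v -> v < b -> (f u <= f v)%R.

Lemma rearr_refl a b f : rearr a b f f.
Proof. now split. Qed.

Lemma rearr_trans a b f g h : rearr a b f g -> rearr a b g h -> rearr a b f h.
Proof.
  intros [A1 A2] [B1 B2].
  split; intros; [rewrite B1, A1 | rewrite B2, A2]; auto.
Qed.

Lemma rearr_swap a b f i j : a <= i < b -> a <= j < b -> i <> j ->
  rearr a b f (updR (updR f i (f j)) j (f i)).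
Proof.
  intros Hi Hj Hn. split.
  - intros P. unfold cnt.
    set (g := fun x => if Nat.eqb x i then P (f j) else P (f x)).
    assert (E1 : cb g a (b - a) + b2n (P (f i)) =
      cb (fun x => P (f x)) a (b - a) + b2n (P (f j)))
      by (apply (cb_upd (fun x => P (f x))); lia).
    assert (E2 := cb_upd g a (b - a) j (P (f i)) ltac:(lia)).
    assert (Eg : g j = P (f j)) by (unfold g; destruct (Nat.eqb_spec j i); congruence).
    rewrite Eg in E2.
    rewrite (cb_ext _ (fun x => if Nat.eqb x j then P (f i) else g x)); [lia|].
    intros x _. unfold updR, g. now destruct (Nat.eqb x j), (Nat.eqb x i).
  - intros x Hx. unfold updR.
    destruct (Nat.eqb_spec x j); [lia|]. destruct (Nat.eqb_spec x i); [lia | auto].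
Qed.

(* Variables: 0-4 hold [n], [k], 0, 1 and [d]; 5 the number of balls; 6, 7 are points
   and 8 a coordinate; 9, 10 are indices; 11 the number of distances left, 12 is [64 k];
   13 the block length, 14 the number of surviving elements, 15-16 the current block,
   17 the output position, 18, 19 loop counters, 20 the rank of the pivot, 22 is [d + 1],
   23 the round.  Arrays: 0 points, 1 radii, 2 inverse radii, 3 distances, 4 and 5 work
   space, 6 output. *)
Definition sort_seg : cmd aop :=
  Blk [NPlus 18 15 2] ;;
  for_ 18 16
    (Blk [NPlus 19 18 3] ;;
     for_ 19 16
       (Blk [Ld 1 4 18; Ld 2 4 19] ;; If (TR 2 1) (Blk [Sto 4 18 2; Sto 4 19 1]))).

(** A quadratic exchange sort suffices: about [N / s] blocks at cost [s^2] each stay within the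
    [N s] allowed for a round. *)
Lemma sort_seg_spec sz s a b :
  nv s 2 = 0 -> nv s 3 = 1 -> nv s 15 = a -> nv s 16 = b -> a <= b -> b <= sz 4 ->
  tot (aok sz) act aval sort_seg s (20 * ((b - a + 1) * (b - a + 1))) (fun s' =>
    rearr a b (av s 4) (av s' 4) /\ sorted (av s' 4) a b).
Proof.
  intros H2 H3 Ha Hb Hab Hsz. unfold sort_seg.
  set (L := b - a). assert (HL : L = b - a) by reflexivity. clearbody L.
  eapply tot_blk_then with (T2 := L * (9 * L + 6 + 3) + 2); [now split | | cbn [length]; nia].
  set (s1 := acts _ _ _).
  apply tot_for with (Inv := fun i s' => rearr a b (av s 4) (av s' 4) /\
      forall u v, a <= u < i -> u <= v < b -> (av s' 4 u <= av s' 4 v)%R)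
    (a := a) (N := b) (c := 9 * L + 6);
    try reflexivity; try (unfold s1; ev; lia).
  - split; [apply rearr_refl | intros; lia].
  - intros i s2 Hi F2 Ei [Hr Hs].
    eapply tot_blk_then with (T2 := L * (6 + 3) + 2);
      [now split | | cbn [length]; lia].
    set (s3 := acts _ _ _).
    apply tot_for with (Inv := fun j s' => rearr a b (av s 4) (av s' 4) /\
        (forall u v, a <= u < i -> u <= v < b -> (av s' 4 u <= av s' 4 v)%R) /\
        (forall v, i <= v < j -> (av s' 4 i <= av s' 4 v)%R))
      (a := S i) (N := b) (c := 6); try reflexivity.
    + unfold s3. ev. frame. unfold s1. ev. lia.
    + unfold s3. ev. frame. unfold s1. ev. lia.
    + unfold s3. ev. frame. unfold s1. ev. lia.
    + lia.
    + unfold s3. ev. repeat split; auto; try apply Hr.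
      intros v Hv. replace v with i by lia. lra.
    + assert (b - S i <= L) by lia. nia.
    + intros j s4 Hj F4 Ej (Hr4 & Hs4 & Hm4).
      assert (E18 : nv s4 18 = i) by (frame; unfold s3; ev; assumption).
      eapply tot_blk_then with (T2 := 4); [ev; lia | | cbn [length]; lia].
      ev. apply tot_if with (T := 2); [| |lia]; ev; intros Hv;
        destruct (Rlt_dec _ _) as [Hlt|Hge] in Hv; try discriminate; rewrite ?E18, ?Ej in *.
      * apply tot_blk; [ev; rewrite ?E18, ?Ej; lia | cbn; lia |].
        ev. rewrite E18, Ej. split; [|split].
        -- apply rearr_trans with (av s4 4); [assumption|].
           apply rearr_swap; lia.
        -- intros u v Hu Hv'. unfold updR.
           destruct (Nat.eqb_spec u j); [lia|]. destruct (Nat.eqb_spec u i); [lia|].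
           destruct (Nat.eqb_spec v j); [apply Hs4; lia|].
           destruct (Nat.eqb_spec v i); apply Hs4; lia.
        -- intros v Hv'. unfold updR. rewrite Nat.eqb_refl.
           destruct (Nat.eqb_spec i j); [lia|].
           destruct (Nat.eqb_spec v j); [lra|].
           destruct (Nat.eqb_spec v i); [lra|].
           specialize (Hm4 v ltac:(lia)). lra.
      * ev. split; [assumption | split; [assumption|]].
        intros v Hv'. destruct (Nat.eq_dec v j) as [->|Hn]; [lra | apply Hm4; lia].
    + intros s4 F4 Ej (Hr4 & Hs4 & Hm4). ev. split; [assumption|].
      intros u v Hu Hv. destruct (Nat.eq_dec u i) as [->|Hn]; [apply Hm4; lia|].
      apply Hs4; lia.
  - intros s2 F2 Ei [Hr Hs]. split; [assumption|].
    intros u v Hu Huv Hv. apply Hs; lia.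
Qed.

(** * One compaction round *)

(** Turns counts into positions, both for the kept elements of a block and for the final pivot. *)
Lemma sorted_threshold P f a len : down P -> sorted f a (a + len) ->
  cnt P f a len <= len /\
  forall i, i < len -> P (f (a + i)) = (i <? cnt P f a len).
Proof.
  intros HP. unfold cnt. induction len as [|l IH]; intros Hs; cbn; [split; [lia | intros; lia]|].
  destruct IH as [Hc Ht]; [intros u v Hu Huv Hv; apply Hs; lia|].
  destruct (P (f (a + l))) eqn:E; cbn.
  - assert (A : forall i, i < l -> P (f (a + i)) = true).
    { intros i Hi. apply HP with (f (a + l)); auto. apply Hs; lia. }
    rewrite (cb_true _ a l).
    + split; [lia|]. intros i Hi. symmetry. destruct (Nat.eq_dec i l) as [->|Hn].
      * rewrite E. apply Nat.ltb_lt. lia.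
      * rewrite A by lia. apply Nat.ltb_lt. lia.
    + intros i Hi. replace i with (a + (i - a)) by lia. apply A. lia.
  - rewrite Nat.add_0_r. split; [lia|]. intros i Hi.
    destruct (Nat.eq_dec i l) as [->|Hn]; [|apply Ht; lia].
    rewrite E. symmetry. apply Nat.ltb_ge. lia.
Qed.

(** With [c] elements of the sorted block satisfying [P], the kept one at offset [4 x + 3] satisfies
    it iff [4 (x + 1) <= c]; so the kept count is [c / 4] rounded down. Starting at offset 3 is what
    makes the error one-sided. *)
Lemma keep_count P f h a len o t : down P -> sorted f a (a + len) ->
  4 * t <= len -> len <= 4 * t + 3 ->
  (forall x, x < t -> h (o + x) = f (a + 4 * x + 3)) ->
  4 * cnt P h o t <= cnt P f a len /\ cnt P f a len <= 4 * cnt P h o t + 3.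
Proof.
  intros HP Hs Ht Ht' Hh. destruct (sorted_threshold P f a len HP Hs) as [Hc Hth].
  set (c := cnt P f a len) in *. clearbody c.
  assert (G : forall u, u <= t -> (4 * u <= c -> cnt P h o u = u) /\
    (c <= 4 * u + 3 -> 4 * cnt P h o u <= c <= 4 * cnt P h o u + 3)).
  { unfold cnt. induction u as [|u IH]; intros Hu; cbn [cb]; [lia|].
    rewrite Hh, <- Nat.add_assoc, Hth by lia.
    destruct (Nat.ltb_spec (4 * u + 3) c); cbn [b2n]; lia. }
  destruct (G t (le_n t)). lia.
Qed.

Definition keep_seg : cmd aop :=
  Blk [NPlus 18 15 3; NPlus 18 18 3; NPlus 18 18 3] ;;
  While (TN 18 16)
    (Blk [Ld 1 4 18; Sto 5 17 1; NPlus 17 17 3;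
          NPlus 18 18 3; NPlus 18 18 3; NPlus 18 18 3; NPlus 18 18 3]).

Lemma keep_seg_spec sz s a b o :
  nv s 3 = 1 -> nv s 15 = a -> nv s 16 = b -> nv s 17 = o ->
  a <= b -> b <= sz 4 -> 4 * o <= a -> sz 5 = sz 4 ->
  tot (aok sz) act aval keep_seg s (9 * (b - a) + 5) (fun s' =>
    exists t, nv s' 17 = o + t /\ 4 * t <= b - a /\ b - a <= 4 * t + 3 /\
      (forall x, x < t -> av s' 5 (o + x) = av s 4 (a + 4 * x + 3)) /\
      (forall y, y < o -> av s' 5 y = av s 5 y)).
Proof.
  intros H3 Ha Hb Ho Hab Hsz Hoa H54. unfold keep_seg.
  eapply tot_blk_then with (T2 := 9 * (b - a) + 2); [now split | | cbn [length]; lia].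
  set (s1 := acts _ _ _).
  apply tot_loop with (Phi := fun s => 9 * (b - nv s 18))
    (Inv := fun s' => exists t, nv s' 18 = a + 4 * t + 3 /\ nv s' 17 = o + t /\
      4 * t <= b - a /\
      (forall x, x < t -> av s' 5 (o + x) = av s 4 (a + 4 * x + 3)) /\
      (forall y, y < o -> av s' 5 y = av s 5 y)).
  - exists 0. unfold s1. ev. repeat split; try lia; auto; intros; lia.
  - unfold s1. ev. lia.
  - intros s2 F2 (t & E18 & E17 & Ht & Hx & Hy) Hv. cbn [aval] in Hv.
    apply Nat.ltb_lt in Hv. framein Hv. unfold s1 in Hv. evin Hv.
    assert (E3 : nv s2 3 = 1) by (frame; exact H3).
    assert (E4 : av s2 4 = av s 4) by (frame; reflexivity).
    exists 7. apply tot_blk; [ev; rewrite E17, E18; lia | cbn; lia |].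
    ev. rewrite E3, E4, E17, E18. split; [|lia].
    exists (S t). repeat split; try lia.
    + intros x Hxt. unfold updR. destruct (Nat.eqb_spec (o + x) (o + t)) as [E|E].
      * f_equal. lia.
      * apply Hx. lia.
    + intros y Hyo. unfold updR. destruct (Nat.eqb_spec y (o + t)); [lia | auto].
  - intros s2 F2 (t & E18 & E17 & Ht & Hx & Hy) Hv. cbn [aval] in Hv.
    apply Nat.ltb_ge in Hv. framein Hv. unfold s1 in Hv. evin Hv.
    exists t. repeat split; auto; lia.
Qed.

Definition thin_block : cmd aop :=
  Blk [NPlus 16 15 13] ;;
  If (TN 14 16) (Blk [NPlus 16 14 2]) ;;
  sort_seg ;;
  keep_seg ;;
  Blk [NPlus 15 16 2].

Definition thin : cmd aop :=
  Blk [NPlus 15 2 2; NPlus 17 2 2] ;;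
  While (TN 15 14) thin_block ;;
  Blk [NPlus 18 2 2] ;;
  for_ 18 17 (Blk [Ld 1 5 18; Sto 4 18 1]) ;;
  Blk [NPlus 14 17 2].

(** [4 * o <= a] keeps the stores into array 5 in range. Array 4 is unchanged from [b] on, where the
    later blocks are still to be read. *)
Lemma thin_block_spec sz s a w N o :
  nv s 2 = 0 -> nv s 3 = 1 -> nv s 13 = w -> nv s 14 = N -> nv s 15 = a -> nv s 17 = o ->
  1 <= w -> a < N -> N <= sz 4 -> sz 5 = sz 4 -> 4 * o <= a ->
  tot (aok sz) act aval thin_block s (150 * (w * w)) (fun s' =>
    exists b o', b = Nat.min (a + w) N /\ nv s' 15 = b /\ nv s' 17 = o' /\
      (forall x, b <= x -> av s' 4 x = av s 4 x) /\
      (forall P, down P -> cnt P (av s' 5) 0 o = cnt P (av s 5) 0 o) /\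
      o <= o' /\
      (forall P, down P -> 4 * cnt P (av s' 5) o (o' - o) <= cnt P (av s 4) a (b - a) <=
        4 * cnt P (av s' 5) o (o' - o) + 3)).
Proof.
  intros H2 H3 H13 H14 H15 H17 Hw HaN HN H54 Ho. unfold thin_block.
  set (b := Nat.min (a + w) N).
  assert (Hb : a < b <= a + w /\ b <= N) by (unfold b; lia).
  eapply tot_blk_then with (T2 := 144 * (w * w) + 5); [now split | | cbn [length]; nia].
  set (s1 := acts _ _ _).
  apply tot_then with (T1 := 3) (T2 := 144 * (w * w) + 2) (Q1 := fun s2 => nv s2 16 = b).
  { apply tot_if with (T := 1); [| |lia]; unfold s1; ev; rewrite H13, H14, H15; intros Hv.
    - apply Nat.ltb_lt in Hv. apply tot_blk; [now split | cbn; lia |].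
      ev. rewrite H2, H14. lia.
    - apply Nat.ltb_ge in Hv. lia. }
  2: lia.
  intros s2 F2 E16.
  assert (E2 : nv s2 2 = 0) by (frame; exact H2).
  assert (E3 : nv s2 3 = 1) by (frame; exact H3).
  assert (E15 : nv s2 15 = a) by (frame; exact H15).
  assert (E4 : av s2 4 = av s 4) by (frame; reflexivity).
  assert (HL : b - a + 1 <= 2 * w) by lia.
  apply tot_then with (T1 := 80 * (w * w)) (T2 := 30 * (w * w))
    (Q1 := fun s' => rearr a b (av s2 4) (av s' 4) /\ sorted (av s' 4) a b).
  { eapply tot_weaken; [apply (sort_seg_spec sz s2 a b); auto; lia | | auto].
    assert ((b - a + 1) * (b - a + 1) <= (2 * w) * (2 * w)) by (apply Nat.mul_le_mono; lia).
    lia. }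
  2: nia.
  intros s3 F3 [[Hr1 Hr2] Hs].
  assert (E33 : nv s3 3 = 1) by (frame; exact H3).
  assert (E315 : nv s3 15 = a) by (frame; exact H15).
  assert (E316 : nv s3 16 = b) by (frame; exact E16).
  assert (E317 : nv s3 17 = o) by (frame; exact H17).
  assert (E32 : nv s3 2 = 0) by (frame; exact H2).
  assert (E35 : av s3 5 = av s 5) by (frame; reflexivity).
  eapply tot_then with (T2 := 1);
    [apply (keep_seg_spec sz s3 a b o); auto; lia | |].
  2: { assert (b - a <= w) by lia. nia. }
  intros s4 F4 (t & E417 & Ht & Ht' & Hx & Hy).
  apply tot_blk; [now split | cbn; lia |].
  ev. exists b, (o + t).
  assert (E416 : nv s4 16 = b) by (frame; exact E16).
  assert (E42 : nv s4 2 = 0) by (frame; exact H2).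
  rewrite E416, E42. repeat split; try lia.
  - intros x Hbx. frame. rewrite Hr2, E4 by lia. reflexivity.
  - intros P HP. apply cb_ext. intros i Hi. now rewrite Hy, E35 by lia.
  - replace (o + t - o) with t by lia. rewrite <- E4, <- Hr1.
    apply (keep_count P (av s3 4) (av s4 5) a (b - a) o t); auto.
    now replace (a + (b - a)) with b by lia.
  - replace (o + t - o) with t by lia. rewrite <- E4, <- Hr1.
    apply (keep_count P (av s3 4) (av s4 5) a (b - a) o t); auto.
    now replace (a + (b - a)) with b by lia.
Qed.

(** Every block contributes at most 3 to the rounding error of a count. All blocks but the last are
    full, whence [nb * w <= N + w]. *)
Lemma thin_spec sz s w N :
  nv s 2 = 0 -> nv s 3 = 1 -> nv s 13 = w -> nv s 14 = N ->
  1 <= w -> w < N -> N <= sz 4 -> sz 5 = sz 4 ->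
  tot (aok sz) act aval thin s (400 * (N * w)) (fun s' =>
    exists N' nb, nv s' 14 = N' /\ nb * w <= N + w /\
      forall P, down P ->
        4 * cnt P (av s' 4) 0 N' <= cnt P (av s 4) 0 N <= 4 * cnt P (av s' 4) 0 N' + 3 * nb).
Proof.
  intros H2 H3 H13 H14 Hw HwN HN H54. unfold thin.
  eapply tot_blk_then with (T2 := 398 * (N * w)); [now split | | cbn [length]; nia].
  set (s1 := acts _ _ _).
  apply tot_then with (T1 := 320 * (N * w) + 2) (T2 := 5 * N + 4)
    (Q1 := fun s' => exists o nb, nv s' 17 = o /\ nb * w <= N + w /\
      forall P, down P ->
        4 * cnt P (av s' 5) 0 o <= cnt P (av s 4) 0 N <= 4 * cnt P (av s' 5) 0 o + 3 * nb).
  3: nia.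
  (* The summand [w] in the potential pays for a last block that is short but charged as a full
     one. *)
  - apply tot_loop with
      (Phi := fun s => if nv s 15 <? N then 160 * w * (N - nv s 15 + w) else 0)
      (Inv := fun s' => exists a o nb, nv s' 15 = a /\ nv s' 17 = o /\ a <= N /\
        nb * w <= N + w /\ (a < N -> nb * w = a) /\
        (forall x, a <= x -> av s' 4 x = av s 4 x) /\
        forall P, down P ->
          4 * cnt P (av s' 5) 0 o <= cnt P (av s 4) 0 a <= 4 * cnt P (av s' 5) 0 o + 3 * nb).
    + exists 0, 0, 0. unfold s1. ev. rewrite H2. repeat split; try lia.
      all: intros; cbn; lia.
    + unfold s1. ev. rewrite H2. cbn [Nat.add]. destruct (0 <? N); nia.
    + intros s2 F2 (a & o & nb & E15 & E17 & Ha & Hnb & Hnb' & Hx & HP) Hv.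
      cbn [aval] in Hv. apply Nat.ltb_lt in Hv.
      assert (E14 : nv s2 14 = N) by (frame; exact H14).
      rewrite E14, E15 in Hv. specialize (Hnb' Hv).
      exists (150 * (w * w)).
      (* The constant predicate turns the count estimate into one for lengths. *)
      assert (Ho : 4 * o <= a).
      { destruct (HP _ down_true) as [H _]. unfold cnt in H. rewrite !cb_true in H by auto. lia. }
      eapply tot_weaken; [apply (thin_block_spec sz s2 a w N o); auto; frame; auto | lia |].
      intros s3 (b & o' & Hb & G15 & G17 & Gx & G0 & Goo & GP). split.
      * exists b, o', (S nb). repeat split; auto; try lia; try nia.
        -- intros x Hbx. rewrite Gx by lia. apply Hx. lia.
        -- replace o' with (o + (o' - o)) by lia. replace b with (a + (b - a)) by lia.
           unfold cnt in *. rewrite !cb_app. cbn [Nat.add].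
           specialize (G0 P H). specialize (GP P H). specialize (HP P H).
           replace (cb (fun i => P (av s 4 i)) a (b - a)) with
             (cb (fun i => P (av s2 4 i)) a (b - a))
             by (apply cb_ext; intros i Hi; rewrite Hx by lia; reflexivity).
           lia.
        -- replace o' with (o + (o' - o)) by lia. replace b with (a + (b - a)) by lia.
           unfold cnt in *. rewrite !cb_app. cbn [Nat.add].
           specialize (G0 P H). specialize (GP P H). specialize (HP P H).
           replace (cb (fun i => P (av s 4 i)) a (b - a)) with
             (cb (fun i => P (av s2 4 i)) a (b - a))
             by (apply cb_ext; intros i Hi; rewrite Hx by lia; reflexivity).
           lia.
      * rewrite G15, E15. destruct (Nat.ltb_spec a N); [|lia].
        assert (2 <= 10 * (w * w)) by nia.
        destruct (Nat.ltb_spec b N).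
        -- replace (N - a + w) with (N - b + w + w) by lia. nia.
        -- nia.
    + intros s2 F2 (a & o & nb & E15 & E17 & Ha & Hnb & Hnb' & Hx & HP) Hv.
      cbn [aval] in Hv. apply Nat.ltb_ge in Hv.
      assert (E14 : nv s2 14 = N) by (frame; exact H14).
      replace a with N in * by lia. exists o, nb. auto.
  - intros s2 F2 (o & nb & E17 & Hnb & HP).
    assert (Ho : 4 * o <= N).
    { destruct (HP _ down_true) as [H _]. unfold cnt in H. rewrite !cb_true in H by auto. lia. }
    eapply tot_blk_then with (T2 := 5 * N + 3); [now split | | cbn [length]; lia].
    set (s3 := acts _ _ _).
    assert (E30 : nv s2 2 = 0) by (frame; exact H2).
    apply tot_then with (T1 := 5 * o + 2) (T2 := 1)
      (Q1 := fun s' => forall x, x < o -> av s' 4 x = av s2 5 x).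
    3: lia.
    + apply tot_for with (Inv := fun i s' => forall x, x < i -> av s' 4 x = av s2 5 x)
        (a := 0) (N := o) (c := 2); try reflexivity; try (unfold s3; ev; frame; assumption).
      * unfold s3. ev. lia.
      * lia.
      * intros; lia.
      * lia.
      * intros i s4 Hi F4 Ei HI. apply tot_blk; [ev; rewrite Ei; lia | cbn; lia |].
        ev. rewrite Ei. intros x Hxi. unfold updR.
        destruct (Nat.eqb_spec x i) as [->|Hn]; [|apply HI; lia].
        frame. reflexivity.
      * auto.
    + intros s4 F4 Hx. apply tot_blk; [now split | cbn; lia |].
      assert (E41 : nv s4 17 = o) by (frame; exact E17).
      assert (E42 : nv s4 2 = 0) by (frame; exact E30).
      ev. rewrite E41, E42, Nat.add_0_r. exists o, nb. split; [auto | split; [auto|]].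
      intros P HPd.
      replace (cnt P (av s4 4) 0 o) with (cnt P (av s2 5) 0 o); [auto|].
      apply cb_ext. intros i Hi. now rewrite Hx by lia.
Qed.

(** * Pivot selection and truncation *)

Definition pivot : cmd aop :=
  Blk [NCst 13 64; NCst 20 4; NPlus 14 11 2] ;;
  While (TN 13 14) (thin ;; Blk [NPlus 13 13 13; NPlus 20 20 20]) ;;
  Blk [NPlus 15 2 2; NPlus 16 14 2] ;;
  sort_seg ;;
  Blk [Ld 3 4 20].

Lemma cnt_all f a len : cnt (fun _ => true) f a len = len.
Proof. now apply cb_true. Qed.

(** Here [h] is the rank to be taken and [16 h] the block length. The invariant on the error says
    [E <= (3/16) N (1 - 4/h)]. A round with [nb] blocks adds
    [3 nb w <= 6 w M / (16 h) <= 3 N / (8 h)], exactly the growth of this bound when [h] doubles. At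
    the end at most [w h + E <= N/2 + 3 N/16] values lie below the pivot, while
    [N <= w M + E <= 16 w h + 3 N/16] gives [N <= 20 w h], so the pivot's rank is not too small
    either. *)
Lemma pivot_spec sz s N :
  nv s 2 = 0 -> nv s 3 = 1 -> nv s 11 = N -> 64 < N -> N <= sz 4 -> sz 5 = sz 4 ->
  tot (aok sz) act aval pivot s (1100 * (64 * N)) (fun s' =>
    4 * cnt (below (rv s' 3)) (av s 4) 0 N <= 3 * N /\
    N <= 64 * cnt (upto (rv s' 3)) (av s 4) 0 N).
Proof.
  intros H2 H3 H11 HN HNsz H54. unfold pivot.
  eapply tot_blk_then with (T2 := 1090 * (64 * N)); [now split | | cbn [length]; lia].
  set (s1 := acts _ _ _).
  (* [w] is the weight 4^j of a surviving element, [E] the accumulated rounding error *)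
  apply tot_then with (T1 := 1000 * (64 * N) + 2) (T2 := 82 * (64 * N))
    (Q1 := fun s' => exists h M w E, nv s' 20 = h /\ nv s' 14 = M /\ M <= N /\ M <= 16 * h /\
      M * (16 * h) <= 64 * N /\
      (forall P, down P -> w * cnt P (av s' 4) 0 M <= cnt P (av s 4) 0 N <=
        w * cnt P (av s' 4) 0 M + E) /\
      16 * (h * E) + 12 * N <= 3 * (N * h) /\ 4 <= h /\
      2 * (w * h) <= N /\ h < M).
  3: lia.
  - apply tot_loop with
      (Phi := fun s => 1000 * (nv s 14 * nv s 13))
      (Inv := fun s' => exists h M w E, nv s' 13 = 16 * h /\ nv s' 20 = h /\ nv s' 14 = M /\
      M <= N /\ M * (16 * h) <= 64 * N /\
      (forall P, down P -> w * cnt P (av s' 4) 0 M <= cnt P (av s 4) 0 N <=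
        w * cnt P (av s' 4) 0 M + E) /\
      16 * (h * E) + 12 * N <= 3 * (N * h) /\ 4 <= h /\
      ((h = 4 /\ M = N) \/ (2 * (w * h) <= N /\ h < M))).
    + exists 4, N, 1, 0. unfold s1. ev. rewrite H2, H11. repeat split; auto; lia.
    + unfold s1. ev. rewrite H2, H11. lia.
    + intros s2 F2 (h & M & w & E & E13 & E20 & E14 & HM & HMh & HP & HE & Hh & _) Hv.
      cbn [aval] in Hv. apply Nat.ltb_lt in Hv. rewrite E13, E14 in Hv.
      exists (400 * (M * (16 * h)) + 2).
      apply tot_then with (T1 := 400 * (M * (16 * h))) (T2 := 2)
        (Q1 := fun s' => exists M' nb, nv s' 14 = M' /\ nb * (16 * h) <= M + 16 * h /\
          forall P, down P ->
          4 * cnt P (av s' 4) 0 M' <= cnt P (av s2 4) 0 M <= 4 * cnt P (av s' 4) 0 M' + 3 * nb).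
      { apply (thin_spec sz s2 (16 * h) M); auto; try lia; frame; auto. }
      2: lia.
      intros s3 F3 (M' & nb & G14 & Hnb & GP).
      apply tot_blk; [now split | cbn; lia |]. ev.
      assert (G13 : nv s3 13 = 16 * h) by (frame; exact E13).
      assert (G20 : nv s3 20 = h) by (frame; exact E20).
      rewrite G13, G20, G14, E13, E14.
      pose proof (GP _ down_true) as GT. rewrite !cnt_all in GT.
      pose proof (HP _ down_true) as HT. rewrite !cnt_all in HT.
      (* The list shrinks to at most a quarter while the block length doubles, so the potential at
         least halves and pays for the round. *)
      assert (D4 : M' * (16 * h + 16 * h) * 2 <= M * (16 * h)) by nia.
      split.
      * exists (h + h), M', (4 * w), (E + w * (3 * nb)).
        split; [lia | split; [auto | split; [auto | split; [lia | split; [lia | split]]]]].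
        -- intros P HPd. specialize (GP P HPd). specialize (HP P HPd). nia.
        -- assert (Q1 : w * (nb * (16 * h)) <= w * (2 * M)) by (apply Nat.mul_le_mono_l; lia).
           (* By the loop test the block length is below [M], so [nb * (16 * h) <= 2 * M]; also
              [w * M <= N]. *)
           assert (Q2 : 8 * (w * nb * h) <= N) by nia.
           split; [nia | split; [lia | right; split]].
           (* For the new weight and rank, [2 (4 w) (2 h) = 16 w h <= w M <= N]. *)
           ++ assert (w * (16 * h) <= w * M) by (apply Nat.mul_le_mono_l; lia). nia.
           ++ assert (nb * 64 <= nb * (16 * h)) by (apply Nat.mul_le_mono_l; lia). lia.
      * assert (1 <= M * (16 * h)) by nia. nia.
    + intros s2 F2 (h & M & w & E & E13 & E20 & E14 & HM & HMh & HP & HE & Hh & Hc) Hv.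
      cbn [aval] in Hv. apply Nat.ltb_ge in Hv. rewrite E13, E14 in Hv.
      exists h, M, w, E.
      (* [64 < N] forces at least one round, so the initial alternative is impossible on exit. *)
      destruct Hc as [[-> ->]|[Hc1 Hc2]]; [lia|]. repeat split; auto; apply HP; auto.
  - intros s2 F2 (h & M & w & E & E20 & E14 & HM & HM' & HMh & HP & HE & Hh & Hwh & HhM).
    eapply tot_blk_then with (T2 := 81 * (64 * N)); [now split | | cbn [length]; lia].
    set (s3 := acts _ _ _).
    assert (E2 : nv s2 2 = 0) by (frame; exact H2).
    assert (E3 : nv s2 3 = 1) by (frame; exact H3).
    apply tot_then with (T1 := 80 * (64 * N)) (T2 := 1)
      (Q1 := fun s' => rearr 0 M (av s3 4) (av s' 4) /\ sorted (av s' 4) 0 M).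
    3: lia.
    + eapply tot_weaken; [apply (sort_seg_spec sz s3 0 M); unfold s3; ev; auto; try lia | | auto].
      rewrite Nat.sub_0_r.
      assert ((M + 1) * (M + 1) <= 4 * (M * (16 * h))) by nia. lia.
    + intros s4 F4 [[Hr _] Hs].
      assert (G20 : nv s4 20 = h) by (frame; exact E20).
      apply tot_blk; [ev; rewrite G20; lia | cbn; lia |].
      ev. rewrite G20. rewrite Nat.sub_0_r in Hr.
      (* Indices start at 0: at most [h] survivors are below [x], and at least [h + 1] are at most
         [x]. *)
      set (x := av s4 4 h).
      assert (Hs' : sorted (av s4 4) 0 (0 + M)) by exact Hs.
      destruct (sorted_threshold (below x) (av s4 4) 0 M (down_below x) Hs') as [_ T1].
      destruct (sorted_threshold (upto x) (av s4 4) 0 M (down_upto x) Hs') as [_ T2].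
      specialize (T1 h HhM). specialize (T2 h HhM). cbn [Nat.add] in T1, T2. fold x in T1, T2.
      assert (L1 : below x x = false) by (unfold below; destruct (Rlt_dec x x); auto; lra).
      assert (L2 : upto x x = true) by (apply upto_true; lra).
      rewrite L1 in T1. rewrite L2 in T2. symmetry in T1, T2.
      apply Nat.ltb_ge in T1. apply Nat.ltb_lt in T2. rewrite Hr in T1, T2.
      pose proof (HP _ (down_below x)) as A1. pose proof (HP _ (down_upto x)) as A2.
      pose proof (HP _ down_true) as A3. rewrite !cnt_all in A3.
      change (av s3 4) with (av s2 4) in T1, T2.
      assert (HE' : 16 * E <= 3 * N) by nia.
      split; nia.
Qed.

(** The store precedes the test. This is harmless: the writing position never overtakes the reading
    one, and a rejected value is overwritten or ends beyond the new length. *)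
Definition truncate : cmd aop :=
  Blk [NPlus 18 2 2; NPlus 17 2 2] ;;
  for_ 18 11 (Blk [Ld 1 3 18; Sto 3 17 1] ;; If (TR 1 3) (Blk [NPlus 17 17 3])) ;;
  Blk [NPlus 11 17 2].

Lemma truncate_spec sz s N :
  nv s 2 = 0 -> nv s 3 = 1 -> nv s 11 = N -> N <= sz 3 ->
  tot (aok sz) act aval truncate s (9 * N + 5) (fun s' =>
    exists m, nv s' 11 = m /\ forall P, cnt P (av s' 3) 0 m =
      cnt (fun v => P v && below (rv s 3) v) (av s 3) 0 N).
Proof.
  intros H2 H3 H11 HN. unfold truncate. set (y := rv s 3).
  eapply tot_blk_then with (T2 := 9 * N + 3); [now split | | cbn [length]; lia].
  set (s1 := acts _ _ _).
  apply tot_then with (T1 := 9 * N + 2) (T2 := 1)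
    (Q1 := fun s' => exists m, nv s' 17 = m /\ forall P, cnt P (av s' 3) 0 m =
      cnt (fun v => P v && below y v) (av s 3) 0 N).
  3: lia.
  - apply tot_for with (Inv := fun i s' => exists m, nv s' 17 = m /\ m <= i /\
        (forall x, i <= x -> av s' 3 x = av s 3 x) /\
        forall P, cnt P (av s' 3) 0 m = cnt (fun v => P v && below y v) (av s 3) 0 i)
      (a := 0) (N := N) (c := 6); try reflexivity; try assumption.
    + unfold s1. ev. lia.
    + lia.
    + exists 0. unfold s1. ev. repeat split; auto; lia.
    + lia.
    + intros i s2 Hi F2 Ei (m & E17 & Hm & Hx & HP).
      eapply tot_blk_then with (T2 := 3); [ev; rewrite E17, Ei; lia | | cbn; lia].
      ev. rewrite E17, Ei.
      assert (Ey : rv s2 3 = y) by (frame; reflexivity).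
      assert (E3 : nv s2 3 = 1) by (frame; exact H3).
      assert (G : forall P,
        cnt P (updR (av s2 3) m (av s2 3 i)) 0 m = cnt (fun v => P v && below y v) (av s 3) 0 i).
      { intros P. rewrite <- HP. apply cb_ext. intros x Hx'. unfold updR.
        destruct (Nat.eqb_spec x m); [lia | auto]. }
      assert (Gx : forall x, S i <= x -> updR (av s2 3) m (av s2 3 i) x = av s 3 x).
      { intros x Hx'. unfold updR. destruct (Nat.eqb_spec x m); [lia | apply Hx; lia]. }
      assert (Ei' : av s2 3 i = av s 3 i) by (apply Hx; lia).
      apply tot_if with (T := 1); [| |lia]; ev; rewrite Ey, Ei'; intros Hv;
        destruct (Rlt_dec _ _) as [Hlt|Hge] in Hv; try discriminate.
      * apply tot_blk; [now split | cbn; lia |]. ev. rewrite E17, E3, Nat.add_1_r.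
        exists (S m). rewrite Ei' in *. repeat split; auto; try lia.
        intros P. unfold cnt in *. cbn [cb Nat.add]. rewrite G. unfold updR at 1.
        rewrite Nat.eqb_refl. apply below_true in Hlt. rewrite Hlt, andb_true_r. reflexivity.
      * ev. exists m. rewrite Ei' in *. repeat split; auto.
        intros P. rewrite G. unfold cnt. cbn [cb Nat.add].
        replace (below y (av s 3 i)) with false
          by (symmetry; unfold below; destruct (Rlt_dec (av s 3 i) y); auto; contradiction).
        rewrite andb_false_r. cbn. lia.
    + intros s2 F2 Ei (m & E17 & Hm & Hx & HP). exists m. auto.
  - intros s2 F2 (m & E17 & HP). apply tot_blk; [now split | cbn; lia |].
    assert (E2 : nv s2 2 = 0) by (frame; exact H2).
    ev. rewrite E17, E2, Nat.add_0_r. exists m. auto.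
Qed.

Definition quickselect : cmd aop :=
  Blk [NPlus 11 0 2] ;;
  While (TN 12 11)
    (Blk [NPlus 18 2 2] ;;
     for_ 18 11 (Blk [Ld 1 3 18; Sto 4 18 1]) ;;
     pivot ;;
     truncate).

(* Real variable 3 holds the current bound and array 3 lists the values below it;
   the pivot becomes the new bound, even if fewer than [k] values are below it. *)
Lemma quickselect_spec sz s n k p :
  nv s 0 = n -> nv s 2 = 0 -> nv s 3 = 1 -> nv s 12 = 64 * k ->
  1 <= k -> k <= n -> sz 3 = n -> sz 4 = n -> sz 5 = n ->
  (forall q, q < n -> q <> p -> (0 < av s 3 q)%R) -> (0 < rv s 3)%R ->
  (forall q, q < n -> (av s 3 q < rv s 3)%R) ->
  tot (aok sz) act aval quickselect s (5000 * (64 * n)) (fun s' =>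
    (0 < rv s' 3)%R /\ k <= cnt (upto (rv s' 3)) (av s 3) 0 n /\
    cnt (below (rv s' 3)) (av s 3) 0 n <= 64 * k).
Proof.
  intros H0 H2 H3 H12 Hk Hkn S3 S4 S5 Hpos Hy Hlt. unfold quickselect.
  set (f := av s 3) in *.
  eapply tot_blk_then with (T2 := 4800 * (64 * n) + 2); [now split | | cbn [length]; lia].
  set (s1 := acts _ _ _).
  (* At least a quarter of the list is dropped in each round, which releases [1200 * (64 * N)] for a
     body of cost [1150 * (64 * N)]. *)
  apply tot_loop with (Phi := fun s => 4800 * (64 * nv s 11))
    (Inv := fun s' => exists N, nv s' 11 = N /\ N <= n /\
      (forall P, cnt P (av s' 3) 0 N = cnt (fun v => P v && below (rv s' 3) v) f 0 n) /\
      (0 < rv s' 3)%R /\ k <= cnt (upto (rv s' 3)) f 0 n).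
  - exists n. unfold s1. ev. rewrite H0, H2, Nat.add_0_r. repeat split; auto.
    + intros P. apply cb_ext. intros i Hi.
      replace (below (rv s 3) (f i)) with true by (symmetry; apply below_true, Hlt; lia).
      now rewrite andb_true_r.
    + unfold cnt. rewrite cb_true; [auto|].
      intros i Hi. apply upto_true. specialize (Hlt i ltac:(lia)). lra.
  - unfold s1. ev. rewrite H0, H2. lia.
  - intros s2 F2 (N & E11 & HNn & HP & Hyp & Hkc) Hv. cbn [aval] in Hv.
    apply Nat.ltb_lt in Hv.
    assert (E12 : nv s2 12 = 64 * k) by (frame; exact H12).
    assert (E2 : nv s2 2 = 0) by (frame; exact H2).
    assert (E3 : nv s2 3 = 1) by (frame; exact H3).
    rewrite E11, E12 in Hv. exists (1150 * (64 * N)).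
    eapply tot_blk_then with (T2 := 1140 * (64 * N)); [now split | | cbn [length]; lia].
    set (s3 := acts _ _ _).
    apply tot_then with (T1 := 5 * N + 2) (T2 := 1120 * (64 * N))
      (Q1 := fun s' => forall x, x < N -> av s' 4 x = av s2 3 x).
    3: lia.
    + apply tot_for with (Inv := fun i s' => forall x, x < i -> av s' 4 x = av s2 3 x)
        (a := 0) (N := N) (c := 2); try reflexivity; try assumption.
      * unfold s3. ev. lia.
      * lia.
      * intros; lia.
      * lia.
      * intros i s4 Hi F4 Ei HI. apply tot_blk; [ev; rewrite Ei; lia | cbn; lia |].
        ev. rewrite Ei. intros x Hxi. unfold updR.
        destruct (Nat.eqb_spec x i) as [->|Hn]; [|apply HI; lia].
        frame. reflexivity.
      * auto.
    + intros s4 F4 Hx.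
      assert (G11 : nv s4 11 = N) by (frame; exact E11).
      eapply tot_then with (T2 := 9 * N + 5).
      * apply (pivot_spec sz s4 N); auto; try lia; frame; [exact E2 | exact E3].
      * intros s5 F5 [C1 C2].
        assert (I11 : nv s5 11 = N) by (frame; exact E11).
        apply tot_framed.
        eapply tot_weaken; [apply (truncate_spec sz s5 N); auto; try lia; frame;
          [exact E2 | exact E3] | apply le_n |].
        intros s6 (m & J11 & JP) F6.
        assert (J3 : av s5 3 = av s2 3) by (frame; reflexivity).
        rewrite J3 in JP. set (x := rv s5 3) in *. set (y := rv s2 3) in *.
        set (g := av s2 3) in *.
        assert (Hg : forall P, cnt P (av s4 4) 0 N = cnt P g 0 N).
        { intros P. apply cb_ext. intros i Hi. now rewrite Hx by lia. }
        rewrite Hg in C1, C2.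
        pose proof (HP (fun _ => true)) as A. rewrite cnt_all in A. cbn [andb] in A.
        (* A pivot above the current bound would have all [N] listed values below it, against the
           [3/4] estimate. *)
        assert (Hxy : (x <= y)%R).
        { destruct (Rle_lt_dec x y) as [H|H]; auto. exfalso.
          rewrite HP in C1.
          assert (N = cnt (fun v => below x v && below y v) f 0 n); [|lia].
          rewrite A at 1. apply cb_ext. intros i Hi.
          destruct (below y (f i)) eqn:E; [|now rewrite andb_false_r].
          rewrite andb_true_r. apply below_true in E. symmetry. apply below_true. lra. }
        assert (Hm : forall P, cnt (fun v => P v && below x v) g 0 N =
          cnt (fun v => P v && below x v) f 0 n).
        { intros P. rewrite HP. apply cb_ext. intros i Hi.
          destruct (below x (f i)) eqn:E; [|now rewrite andb_false_r].
          apply below_true in E. replace (below y (f i)) with true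
            by (symmetry; apply below_true; lra). now rewrite andb_true_r. }
        (* With [64 k < N <= 64 * cnt (upto x) g 0 N] this leaves more than [k] values at most [x];
           hence the stopping threshold [64 k]. *)
        assert (HC : cnt (upto x) g 0 N <= cnt (upto x) f 0 n).
        { rewrite HP. apply cb_le. intros i Hi H. now apply andb_true_iff in H. }
        assert (J : rv s6 3 = x) by exact (proj1 (proj2 F6) 3 eq_refl).
        pose proof (JP (fun _ => true)) as B. rewrite cnt_all in B. cbn [andb] in B.
        change (m = cnt (below x) g 0 N) in B.
        rewrite J, J11, E11. split; [exists m; repeat split; auto | lia].
        -- lia.
        -- intros P. now rewrite JP, Hm.
        -- (* at least two values are at most [x], and only that of [p] may be zero *)
           destruct (Rlt_le_dec 0 x) as [H|H]; auto. exfalso.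
           assert (D : cnt (upto x) f 0 n <= 1); [|lia].
           assert (D1 : cnt (upto x) f 0 n <= cb (fun i => if Nat.eqb i p then true else false) 0 n).
           { apply cb_le. intros i Hi E. apply upto_true in E.
             destruct (Nat.eqb_spec i p) as [|Hn]; auto.
             specialize (Hpos i ltac:(lia) Hn). lra. }
           destruct (le_lt_dec n p) as [Hp|Hp].
           ++ rewrite (cb_false _ 0 n) in D1; [lia|].
              intros i Hi. destruct (Nat.eqb_spec i p); [lia | auto].
           ++ pose proof (cb_upd (fun _ => false) 0 n p true ltac:(lia)) as D2.
              rewrite (cb_false (fun _ => false)) in D2 by auto. cbn [b2n] in D2. lia.
        -- lia.
      * lia.
  - intros s2 F2 (N & E11 & HNn & HP & Hyp & Hkc) Hv. cbn [aval] in Hv.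
    apply Nat.ltb_ge in Hv.
    assert (E12 : nv s2 12 = 64 * k) by (frame; exact H12).
    rewrite E11, E12 in Hv. repeat split; auto.
    pose proof (HP (fun _ => true)) as A. rewrite cnt_all in A. cbn [andb] in A.
    change (cnt (below (rv s2 3)) f 0 n <= 64 * k) in |- *.
    change (N = cnt (below (rv s2 3)) f 0 n) in A. lia.
Qed.

(** * Euclidean distance *)

Local Open Scope R_scope.

Lemma sumsq_nonneg d x y : 0 <= sumsq d x y.
Proof. induction d as [|d IH]; cbn [sumsq]; [lra|]. pose proof (pow2_ge_0 (x d - y d)). lra. Qed.

Lemma edist_nonneg d x y : 0 <= edist d x y.
Proof. apply sqrt_pos. Qed.

Lemma sumsq_scale d c x y x' y' :
  (forall l, (l < d)%nat -> x l - y l = c * (x' l - y' l)) ->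
  sumsq d x y = c ^ 2 * sumsq d x' y'.
Proof.
  induction d as [|d IH]; cbn [sumsq]; intros H; [ring|].
  rewrite IH by (intros; apply H; lia). rewrite (H d) by lia. ring.
Qed.

(** One rule for everything linear: [c = -1], [0], [1] give symmetry, reflexivity and
    extensionality, and general [c] the homotheties of the crowding argument. *)
Lemma edist_scale d c x y x' y' :
  (forall l, (l < d)%nat -> x l - y l = c * (x' l - y' l)) ->
  edist d x y = Rabs c * edist d x' y'.
Proof.
  intros H. unfold edist. rewrite (sumsq_scale d c x y x' y' H).
  rewrite sqrt_mult by (try apply pow2_ge_0; apply sumsq_nonneg).
  now rewrite <- Rsqr_pow2, sqrt_Rsqr_abs.
Qed.

Lemma edist_sym d x y : edist d x y = edist d y x.
Proof.
  rewrite (edist_scale d (-1) x y y x) by (intros; ring).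
  rewrite Rabs_left by lra. ring.
Qed.

Lemma edist_ext d x y x' y' :
  (forall l, (l < d)%nat -> x l = x' l) -> (forall l, (l < d)%nat -> y l = y' l) ->
  edist d x y = edist d x' y'.
Proof.
  intros Hx Hy. rewrite (edist_scale d 1 x y x' y').
  - rewrite Rabs_R1. ring.
  - intros l Hl. rewrite Hx, Hy by assumption. ring.
Qed.

Lemma edist_refl d x : edist d x x = 0.
Proof.
  rewrite (edist_scale d 0 x x x x) by (intros; ring). rewrite Rabs_R0. ring.
Qed.

Lemma edist_S d x y :
  edist (S d) x y = sqrt (Rsqr (edist d x y) + Rsqr (x d - y d)).
Proof.
  unfold edist. cbn [sumsq]. rewrite Rsqr_sqrt by apply sumsq_nonneg.
  now rewrite Rsqr_pow2.
Qed.

Lemma edist_coord d x y l : (l < d)%nat -> Rabs (x l - y l) <= edist d x y.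
Proof.
  induction d as [|d IH]; intros Hl; [lia|]. rewrite edist_S.
  destruct (Nat.eq_dec l d) as [->|Hn].
  - rewrite <- sqrt_Rsqr_abs. apply sqrt_le_1_alt.
    pose proof (Rle_0_sqr (edist d x y)). lra.
  - apply Rle_trans with (edist d x y); [apply IH; lia|].
    rewrite <- (sqrt_Rsqr (edist d x y)) at 1 by apply edist_nonneg.
    apply sqrt_le_1_alt. pose proof (Rle_0_sqr (x d - y d)). lra.
Qed.

Lemma edist_box d x y e : 0 <= e ->
  (forall l, (l < d)%nat -> Rabs (x l - y l) <= e) -> edist d x y <= INR d * e.
Proof.
  intros He. induction d as [|d IH]; intros H.
  - cbn. unfold edist. cbn. rewrite sqrt_0. lra.
  - rewrite edist_S, S_INR. specialize (IH ltac:(intros; apply H; lia)).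
    specialize (H d ltac:(lia)). pose proof (edist_nonneg d x y) as H0.
    rewrite <- (sqrt_Rsqr ((INR d + 1) * e)) by (pose proof (pos_INR d); nra).
    apply sqrt_le_1_alt. rewrite (Rsqr_abs (x d - y d)). unfold Rsqr.
    pose proof (Rabs_pos (x d - y d)). nra.
Qed.

(** Cauchy-Schwarz in the plane, from [(a v - u b)^2 >= 0]. It is the step from dimension [d] to
    [d + 1] in the triangle inequality. *)
Lemma hypot_triangle a b u v : 0 <= a -> 0 <= b ->
  sqrt (Rsqr (a + b) + Rsqr (u + v)) <= sqrt (Rsqr a + Rsqr u) + sqrt (Rsqr b + Rsqr v).
Proof.
  intros Ha Hb.
  set (s := sqrt (Rsqr a + Rsqr u)). set (t := sqrt (Rsqr b + Rsqr v)).
  assert (Hs : s * s = a * a + u * u).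
  { apply sqrt_sqrt. unfold Rsqr. nra. }
  assert (Ht : t * t = b * b + v * v).
  { apply sqrt_sqrt. unfold Rsqr. nra. }
  assert (0 <= s) by apply sqrt_pos. assert (0 <= t) by apply sqrt_pos.
  assert (Hc : a * b + u * v <= s * t).
  { apply Rsqr_incr_0_var; [|nra]. unfold Rsqr.
    replace (s * t * (s * t)) with ((s * s) * (t * t)) by ring. rewrite Hs, Ht.
    pose proof (Rle_0_sqr (a * v - u * b)) as Hq. unfold Rsqr in Hq. nra. }
  rewrite <- (sqrt_Rsqr (s + t)) by lra. apply sqrt_le_1_alt. unfold Rsqr. nra.
Qed.

Lemma edist_triangle d x y z : edist d x z <= edist d x y + edist d y z.
Proof.
  induction d as [|d IH].
  - unfold edist. cbn. rewrite sqrt_0. lra.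
  - rewrite !edist_S. replace (x d - z d) with ((x d - y d) + (y d - z d)) by ring.
    eapply Rle_trans; [|apply hypot_triangle; apply edist_nonneg].
    apply sqrt_le_1_alt. apply Rplus_le_compat_r.
    apply Rsqr_incr_1; auto; pose proof (edist_nonneg d x z);
      pose proof (edist_nonneg d x y); pose proof (edist_nonneg d y z); lra.
Qed.

(** * Few larger balls meet a given ball *)

(** Pigeonhole for a grid of [M^d] cells whose cells are never named: a cell is represented by any
    subfamily [g] whose coordinates differ pairwise by at most [e]. Each induction step cuts along
    one more coordinate, so no rounding of reals occurs. *)
Lemma cells_bound (M n B : nat) (e lo : R) (v : nat -> nat -> R) : 0 < e ->
  forall d f,
  (forall i l, (i < n)%nat -> (l < d)%nat -> f i = true -> lo <= v i l < lo + INR M * e) ->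
  (forall g, (forall i, g i = true -> f i = true) ->
     (forall i j l, (i < n)%nat -> (j < n)%nat -> (l < d)%nat -> g i = true -> g j = true ->
        Rabs (v i l - v j l) <= e) -> (cb g 0 n <= B)%nat) ->
  (cb f 0 n <= M ^ d * B)%nat.
Proof.
  intros He. induction d as [|d IH]; intros f Hf Hg.
  - cbn. rewrite Nat.add_0_r. apply Hg; auto. intros; lia.
  - assert (G : forall m,
      (cb (fun i => f i && below (lo + INR m * e) (v i d)) 0 n <= m * (M ^ d * B))%nat).
    { induction m as [|m IHm].
      - rewrite cb_false; [lia|]. intros i Hi. destruct (f i) eqn:E; auto.
        specialize (Hf i d ltac:(lia) ltac:(lia) E). cbn [andb INR]. unfold below.
        destruct (Rlt_dec _ _); auto. lra.
      - rewrite (cb_split _ (fun i => below (lo + INR m * e) (v i d))).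
        assert (A1 : (cb (fun i => (f i && below (lo + INR (S m) * e) (v i d)) &&
            below (lo + INR m * e) (v i d)) 0 n <= m * (M ^ d * B))%nat).
        { eapply Nat.le_trans; [|apply IHm]. apply cb_le. intros i _ H.
          apply andb_true_iff in H as [H1 H2]. apply andb_true_iff in H1 as [H1 _].
          now rewrite H1, H2. }
        assert (A2 : (cb (fun i => (f i && below (lo + INR (S m) * e) (v i d)) &&
            negb (below (lo + INR m * e) (v i d))) 0 n <= M ^ d * B)%nat); [|lia].
        assert (K : forall i, (f i && below (lo + INR (S m) * e) (v i d)) &&
            negb (below (lo + INR m * e) (v i d)) = true ->
            f i = true /\ lo + INR m * e <= v i d < lo + (INR m + 1) * e).
        { intros i H. apply andb_true_iff in H as [H1 H2].
          apply andb_true_iff in H1 as [H1 H3]. split; auto.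
          apply below_true in H3. rewrite S_INR in H3. unfold below in H2.
          destruct (Rlt_dec _ _); [discriminate | lra]. }
        apply IH.
        + intros i l Hi Hl H. apply K in H as [H _]. apply Hf; auto; lia.
        + intros g Hgf Hcl. apply Hg.
          * intros i Hi. now apply K, Hgf.
          * intros i j l Hi Hj Hl Hgi Hgj. destruct (Nat.eq_dec l d) as [->|Hn].
            -- apply Hgf, K in Hgi, Hgj. apply Rabs_le. lra.
            -- apply Hcl; auto; lia. }
    eapply Nat.le_trans; [|cbn [Nat.pow]; rewrite <- Nat.mul_assoc; apply (G M)].
    apply cb_le. intros i Hi E. rewrite E. cbn [andb]. apply below_true.
    apply Hf; auto; lia.
Qed.

Lemma exists_argmax (D : nat -> R) g n : (0 < cb g 0 n)%nat ->
  exists p, (p < n)%nat /\ g p = true /\ forall i, (i < n)%nat -> g i = true -> D i <= D p.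
Proof.
  induction n as [|n IH]; cbn [cb Nat.add]; [lia|]. intros H.
  destruct (Nat.eq_dec (cb g 0 n) 0) as [E|E].
  - rewrite E in H. destruct (g n) eqn:Eg; [|cbn in H; lia].
    exists n. repeat split; auto. intros i Hi Hg.
    destruct (Nat.eq_dec i n) as [->|Hn]; [lra|].
    pose proof (cb_pos g 0 n i ltac:(lia) Hg). lia.
  - destruct IH as (p & Hp & Hg & Hm); [lia|].
    destruct (g n) eqn:Eg; [destruct (Rle_dec (D n) (D p)) as [Hd|Hd]|].
    + exists p. repeat split; auto. intros i Hi Hgi.
      destruct (Nat.eq_dec i n) as [->|Hn]; [auto | apply Hm; auto; lia].
    + exists n. repeat split; auto. intros i Hi Hgi.
      destruct (Nat.eq_dec i n) as [->|Hn]; [lra | specialize (Hm i ltac:(lia) Hgi); lra].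
    + exists p. repeat split; auto. intros i Hi Hgi.
      destruct (Nat.eq_dec i n) as [->|Hn]; [congruence | apply Hm; auto; lia].
Qed.

Section Crowd.
Variables (d n B : nat) (pt : nat -> nat -> R) (r : nat -> R) (q : nat).
Hypothesis Hr : forall p, (p < n)%nat -> 0 < r p.
Hypothesis HB : forall p, (p < n)%nat ->
  (cb (fun x => below (r p) (edist d (pt x) (pt p))) 0 n <= B)%nat.
Hypothesis Hq : (q < n)%nat.

Let D (p : nat) : R := edist d (pt p) (pt q).
(** With side [e] a cell has diameter at most [d e < 1/2], and [M e = 9/2 > 4] lets half-open slabs
    starting at -2 cover the closed interval from -2 to 2. *)
Let e : R := / (2 * (INR d + 1)).
Let M : nat := (9 * (d + 1))%nat.

Definition larger_meets (p : nat) : bool :=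
  upto (r p) (r q) && below (r p + r q) (D p).

Lemma cell_size : 0 < e /\ INR d * e < / 2 /\ INR M * e = 9 / 2.
Proof.
  unfold e, M. pose proof (pos_INR d). rewrite mult_INR, plus_INR.
  replace (INR 9) with 9 by (cbn; lra). replace (INR 1) with 1 by reflexivity.
  split; [apply Rinv_0_lt_compat; lra | split; [|field; lra]].
  apply Rmult_lt_reg_r with (2 * (INR d + 1)); [lra|].
  rewrite Rmult_assoc, Rinv_l; lra.
Qed.

Lemma larger_meets_true p : larger_meets p = true -> r q <= r p /\ D p < r p + r q.
Proof.
  unfold larger_meets. rewrite andb_true_iff, upto_true, below_true. auto.
Qed.

Lemma unit_range c p l : 0 < c -> D p <= 2 * c -> (l < d)%nat ->
  -2 <= (pt p l - pt q l) / c < -2 + INR M * e.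
Proof.
  intros Hc HD Hl. destruct cell_size as (_ & _ & ->).
  pose proof (edist_coord d (pt p) (pt q) l Hl) as H. fold (D p) in H.
  assert (Ha : Rabs (pt p l - pt q l) <= 2 * c) by lra.
  assert (Hb : - (2 * c) <= pt p l - pt q l <= 2 * c)
    by (unfold Rabs in Ha; destruct (Rcase_abs _) in Ha; lra).
  assert (-2 <= (pt p l - pt q l) / c <= 2); [|lra].
  split; apply Rmult_le_reg_r with c; auto; unfold Rdiv;
    rewrite Rmult_assoc, Rinv_l; lra.
Qed.

(* Points in a common cell of side [e r_q] are within [r_q / 2] of each other. *)
Lemma near_bound :
  (cb (fun p => larger_meets p && upto (2 * r q) (D p)) 0 n <= M ^ d * B)%nat.
Proof.
  pose proof (Hr q Hq) as Hrq. destruct cell_size as (He & Hde & HM).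
  apply (cells_bound M n B e (-2) (fun p l => (pt p l - pt q l) / r q) He d).
  - intros p l Hp Hl H. apply andb_true_iff in H as [_ H]. apply upto_true in H.
    now apply unit_range.
  - intros g Hg Hcl. destruct (Nat.eq_dec (cb g 0 n) 0) as [E|E]; [lia|].
    (* Any point of the cell can serve as the centre, since all radii concerned are at least
       [r q]. *)
    destruct (cb_exists g 0 n ltac:(lia)) as (p & Hp & Hgp).
    eapply Nat.le_trans; [|apply (HB p); lia]. apply cb_le. intros x Hx Hgx.
    apply below_true.
    assert (Hlp : r q <= r p).
    { apply Hg in Hgp. apply andb_true_iff in Hgp as [Hgp _].
      now apply larger_meets_true in Hgp. }
    rewrite (edist_scale d (r q) (pt x) (pt p)
      (fun l => (pt x l - pt q l) / r q) (fun l => (pt p l - pt q l) / r q))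
      by (intros; field; lra).
    rewrite Rabs_pos_eq by lra.
    assert (edist d (fun l => (pt x l - pt q l) / r q) (fun l => (pt p l - pt q l) / r q)
      <= INR d * e).
    { apply edist_box; [lra|]. intros l Hl. apply Hcl; auto; lia. }
    nra.
Qed.

(* For directions in a common cell, [p] the farther and [x] the nearer point,
   [|x - p| <= D p - D x / 2 < D p - r_q <= r_p]. *)
Lemma far_bound :
  (cb (fun p => larger_meets p && negb (upto (2 * r q) (D p))) 0 n <= M ^ d * B)%nat.
Proof.
  pose proof (Hr q Hq) as Hrq. destruct cell_size as (He & Hde & HM).
  assert (K : forall p, larger_meets p && negb (upto (2 * r q) (D p)) = true ->
    D p < r p + r q /\ 2 * r q < D p).
  { intros p H. apply andb_true_iff in H as [H1 H2]. apply larger_meets_true in H1.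
    unfold upto in H2. destruct (Rle_dec _ _); [discriminate | lra]. }
  apply (cells_bound M n B e (-2) (fun p l => (pt p l - pt q l) / D p) He d).
  - intros p l Hp Hl H. apply K in H. apply unit_range; auto; lra.
  - intros g Hg Hcl. destruct (Nat.eq_dec (cb g 0 n) 0) as [E|E]; [lia|].
    destruct (exists_argmax D g n ltac:(lia)) as (p & Hp & Hgp & Hmax).
    eapply Nat.le_trans; [|apply (HB p); lia]. apply cb_le. intros x Hx Hgx.
    apply below_true.
    pose proof (K p (Hg p Hgp)) as [K1 K2]. pose proof (K x (Hg x Hgx)) as [K3 K4].
    specialize (Hmax x ltac:(lia) Hgx).
    (* [z] lies on the segment from [q] to [p] at distance [D x] from [q]; the path from [x] to [p]
       is broken there. *)
    set (z := fun l => pt q l + D x / D p * (pt p l - pt q l)).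
    eapply Rle_lt_trans; [apply (edist_triangle d _ z)|].
    rewrite (edist_scale d (D x) (pt x) z
      (fun l => (pt x l - pt q l) / D x) (fun l => (pt p l - pt q l) / D p))
      by (intros; unfold z; field; lra).
    rewrite (edist_scale d (D x / D p - 1) z (pt p) (pt p) (pt q))
      by (intros; unfold z; ring).
    fold (D p).
    assert (E1 : edist d (fun l => (pt x l - pt q l) / D x) (fun l => (pt p l - pt q l) / D p)
      <= INR d * e).
    { apply edist_box; [lra|]. intros l Hl. apply Hcl; auto; lia. }
    assert (E2 : D x / D p <= 1).
    { apply Rmult_le_reg_r with (D p); [lra|]. unfold Rdiv.
      rewrite Rmult_assoc, Rinv_l; lra. }
    rewrite (Rabs_pos_eq (D x)) by lra. rewrite (Rabs_left1 (D x / D p - 1)) by lra.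
    replace (- (D x / D p - 1) * D p) with (D p - D x) by (field; lra).
    nra.
Qed.

Lemma larger_meets_bound : (cb larger_meets 0 n <= 2 * M ^ d * B)%nat.
Proof.
  rewrite (cb_split _ (fun p => upto (2 * r q) (D p))).
  pose proof near_bound. pose proof far_bound. lia.
Qed.

End Crowd.

Local Open Scope nat_scope.

(** * The program *)

Definition dist : cmd aop :=
  Blk [RCst 0 0; NPlus 8 2 2] ;;
  for_ 8 4 (Blk [NTimes 9 7 4; NPlus 9 9 8; NTimes 10 6 4; NPlus 10 10 8;
                 Ld 1 0 9; Ld 2 0 10; RMinus 1 1 2; RTimes 1 1 1; RPlus 0 0 1]) ;;
  Blk [RRoot 0 0].

(** Real variable 3 becomes one plus the sum of the distances: positive and strictly above each of
    them, hence a valid first bound for [quickselect]. It remains the radius when [n <= 64 k]. *)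
Definition distances : cmd aop :=
  Blk [RCst 3 1; NPlus 7 2 2] ;; for_ 7 0 (dist ;; Blk [Sto 3 7 0; RPlus 3 3 0]).

Definition radii : cmd aop :=
  Blk [NPlus 6 2 2] ;;
  for_ 6 0 (distances ;; quickselect ;;
            Blk [RCst 1 1; RQuot 1 1 3; Sto 1 6 3; Sto 2 6 1]).

(* Array 2 holds the inverse radii of the live points and 0 for the removed ones. *)
Definition find_best : cmd aop :=
  Blk [RCst 4 0; RCst 5 0; NPlus 7 2 2; NPlus 6 2 2] ;;
  for_ 7 0 (Blk [Ld 1 2 7] ;; If (TR 4 1) (Blk [RPlus 4 1 5; NPlus 6 7 2])).

(** Real variable 4 changes its meaning here, from the best inverse radius to the radius itself, as
    [remove_met] expects. *)
Definition write_ball : cmd aop :=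
  Blk [NTimes 9 6 4; NTimes 10 5 22; NPlus 8 2 2] ;;
  for_ 8 4 (Blk [Ld 1 0 9; Sto 6 10 1; NPlus 9 9 3; NPlus 10 10 3]) ;;
  Blk [Ld 4 1 6; Sto 6 10 4; NPlus 5 5 3].

Definition remove_met : cmd aop :=
  Blk [NPlus 7 2 2] ;;
  for_ 7 0 (dist ;; Blk [Ld 1 1 7; RPlus 1 1 4] ;; If (TR 0 1) (Blk [Sto 2 7 5])).

(** Always [n] rounds; once no point is live, [find_best] returns 0 and the remaining rounds are
    idle. *)
Definition greedy : cmd aop :=
  Blk [NPlus 5 2 2; NPlus 23 2 2] ;;
  for_ 23 0 (find_best ;; If (TR 5 4) (write_ball ;; remove_met)).

Definition program (d : nat) : cmd aop :=
  Blk [NCst 3 1; NCst 2 0; NCst 4 d; NPlus 22 4 3; NCst 12 64; NTimes 12 12 1] ;;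
  radii ;; greedy.

Section Program.
Variables (d n k : nat) (pt : nat -> nat -> R).
Hypothesis Hpt : distinct_pts d n pt.
Hypothesis Hk1 : 1 <= k.
Hypothesis Hkn : k <= n.

Notation ptot := (tot (aok (sizes d n)) act aval).

Record env (s : st) : Prop := Env {
  env0 : nv s 0 = n;
  env2 : nv s 2 = 0;
  env3 : nv s 3 = 1;
  env4 : nv s 4 = d;
  env12 : nv s 12 = 64 * k;
  env22 : nv s 22 = d + 1;
  env_pt : forall i l, i < n -> l < d -> av s 0 (i * d + l) = pt i l }.

Lemma env_framed c s s' :
  existsb (fun r => memb r (mods ntgt c)) [0; 2; 3; 4; 12; 22] = false ->
  memb 0 (mods atgt c) = false -> framed c s s' -> env s -> env s'.
Proof.
  intros H1 H2 (F1 & _ & F3) [E0 E2 E3 E4 E12 E22 Ep].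
  repeat (apply orb_false_iff in H1 as [? H1]).
  split; rewrite ?F1 by assumption; auto. intros i l Hi Hl. rewrite F3; auto.
Qed.

Ltac envt := match goal with
  | F : framed _ _ ?s |- env ?s => refine (env_framed _ _ _ _ _ F _); [reflexivity | reflexivity | envt]
  | |- env (acts act ?l ?s) =>
      refine (env_framed _ _ _ _ _ (acts_framed l s) _); [reflexivity | reflexivity | envt]
  | x := acts act ?l ?s |- env ?x => unfold x; envt
  | _ => assumption
  end.

Lemma index_bound i l : i < n -> l < d -> i * d + l < n * d.
Proof. intros. assert (S i * d <= n * d) by (apply Nat.mul_le_mono_r; lia). lia. Qed.

Lemma dist_spec s p q : env s -> nv s 6 = p -> nv s 7 = q -> p < n -> q < n ->
  ptot dist s (12 * d + 5) (fun s' => rv s' 0 = edist d (pt q) (pt p)).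
Proof.
  intros He Hp Hq Hpn Hqn. unfold dist.
  eapply tot_blk_then with (T2 := 12 * d + 3); [now split | | cbn [length]; lia].
  set (s1 := acts _ _ _).
  assert (He1 : env s1) by envt.
  apply tot_then with (T1 := 12 * d + 2) (T2 := 1)
    (Q1 := fun s' => rv s' 0 = sumsq d (pt q) (pt p)).
  3: lia.
  - apply tot_for with (Inv := fun l s' => rv s' 0 = sumsq l (pt q) (pt p))
      (a := 0) (N := d) (c := 9); try reflexivity; try apply He1.
    + unfold s1. ev. rewrite (env2 _ He). lia.
    + lia.
    + lia.
    + intros l s2 Hl F2 El HI. assert (He2 : env s2) by envt.
      assert (E6 : nv s2 6 = p) by (frame; exact Hp).
      assert (E7 : nv s2 7 = q) by (frame; exact Hq).
      pose proof (index_bound p l Hpn ltac:(lia)). pose proof (index_bound q l Hqn ltac:(lia)).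
      apply tot_blk; [| cbn; lia |].
      * ev. rewrite E6, E7, El, (env4 _ He2). cbn [sizes]. lia.
      * ev. rewrite E6, E7, El, (env4 _ He2), HI.
        rewrite !(env_pt _ He2) by lia. cbn [sumsq]. ring.
    + auto.
  - intros s2 F2 HI. apply tot_blk; [now split | cbn; lia |]. ev. now rewrite HI.
Qed.

Lemma distances_spec s p : env s -> nv s 6 = p -> p < n ->
  ptot distances s (n * (12 * d + 10) + 4) (fun s' => (1 <= rv s' 3)%R /\
    forall q, q < n -> av s' 3 q = edist d (pt q) (pt p) /\ (av s' 3 q < rv s' 3)%R).
Proof.
  intros He Hp Hpn. unfold distances.
  eapply tot_blk_then with (T2 := n * (12 * d + 10) + 2); [now split | | cbn [length]; lia].
  set (s1 := acts _ _ _). assert (He1 : env s1) by envt.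
  apply tot_for with (Inv := fun i s' => (1 <= rv s' 3)%R /\
      forall q, q < i -> av s' 3 q = edist d (pt q) (pt p) /\ (av s' 3 q < rv s' 3)%R)
    (a := 0) (N := n) (c := 12 * d + 7); try reflexivity; try apply He1.
  - unfold s1. ev. rewrite (env2 _ He). lia.
  - lia.
  - unfold s1. ev. split; [lra | intros; lia].
  - lia.
  - intros i s2 Hi F2 Ei [H1 HI]. assert (He2 : env s2) by envt.
    assert (E6 : nv s2 6 = p) by (frame; exact Hp).
    eapply tot_then with (T2 := 2); [apply (dist_spec s2 p i); auto; lia | | lia].
    intros s3 F3 E0.
    assert (E7 : nv s3 7 = i) by (frame; exact Ei).
    assert (G3 : rv s3 3 = rv s2 3) by (frame; reflexivity).
    assert (GA : av s3 3 = av s2 3) by (frame; reflexivity).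
    apply tot_blk; [ev; rewrite E7; cbn [sizes]; lia | cbn; lia |].
    ev. rewrite E7, E0, G3, GA. pose proof (edist_nonneg d (pt i) (pt p)).
    split; [lra|]. intros q Hq. unfold updR. destruct (Nat.eqb_spec q i) as [->|Hn].
    + split; [reflexivity | lra].
    + destruct (HI q ltac:(lia)). split; [assumption | lra].
  - auto.
Qed.

(* The radius of a point is its distance to a neighbour of rank between [k] and [64 k]. *)
Definition radius_ok (p : nat) (r : R) : Prop :=
  (0 < r)%R /\ k <= cb (fun q => upto r (edist d (pt q) (pt p))) 0 n /\
  cb (fun q => below r (edist d (pt q) (pt p))) 0 n <= 64 * k.

(** This is where distinctness of the points enters: only [p] itself is at distance 0 from [p], so a
    radius reaching two points is positive. *)
Lemma edist_pos p q : p < n -> q < n -> q <> p -> (0 < edist d (pt q) (pt p))%R.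
Proof.
  intros Hp Hq Hn. destruct (Hpt q p Hq Hp Hn) as (l & Hl & Hd).
  eapply Rlt_le_trans; [|apply (edist_coord d _ _ l Hl)]. apply Rabs_pos_lt. lra.
Qed.

Lemma radii_spec s : env s ->
  ptot radii s (4000 * (100 * ((n * n) * (d + 1))) + 3) (fun s' =>
    forall p, p < n -> radius_ok p (av s' 1 p) /\ av s' 2 p = (1 / av s' 1 p)%R).
Proof.
  intros He. unfold radii.
  eapply tot_blk_then with (T2 := 4000 * (100 * ((n * n) * (d + 1))) + 2);
    [now split | | cbn [length]; lia].
  set (s1 := acts _ _ _). assert (He1 : env s1) by envt.
  apply tot_for with (Inv := fun i s' => forall p, p < i ->
      radius_ok p (av s' 1 p) /\ av s' 2 p = (1 / av s' 1 p)%R)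
    (a := 0) (N := n) (c := n * (12 * d + 10) + 4 + 5000 * (64 * n) + 4);
    try reflexivity; try apply He1.
  - unfold s1. ev. rewrite (env2 _ He). lia.
  - lia.
  - intros; lia.
  - rewrite Nat.sub_0_r. assert (n * 1 <= n * n) by (apply Nat.mul_le_mono_l; lia). lia.
  - intros p s2 Hp F2 E6 HI. assert (He2 : env s2) by envt.
    eapply tot_then with (T2 := 5000 * (64 * n) + 4);
      [apply (distances_spec s2 p); auto; lia | | lia].
    intros s3 F3 [G1 G2]. assert (He3 : env s3) by envt.
    assert (E36 : nv s3 6 = p) by (frame; exact E6).
    eapply tot_then with (T2 := 4); [| |apply le_n].
    + apply (quickselect_spec (sizes d n) s3 n k p); auto; try apply He3; try lra.
      * intros q Hq Hn. destruct (G2 q Hq) as [-> _]. apply edist_pos; auto; lia.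
      * intros q Hq. apply G2. assumption.
    + intros s4 F4 (J1 & J2 & J3).
      assert (E46 : nv s4 6 = p) by (frame; exact E6).
      assert (A1 : av s4 1 = av s2 1) by (frame; reflexivity).
      assert (A2 : av s4 2 = av s2 2) by (frame; reflexivity).
      apply tot_blk; [ev; rewrite E46; cbn [sizes]; lia | cbn; lia |].
      ev. rewrite E46, A1, A2. intros x Hx. unfold updR.
      destruct (Nat.eqb_spec x p) as [->|Hn]; [|apply HI; lia].
      split; [|reflexivity]. split; [assumption | split].
      * eapply Nat.le_trans; [apply J2|]. apply cb_le. intros q Hq.
        destruct (G2 q ltac:(lia)) as [-> _]. auto.
      * eapply Nat.le_trans; [|apply J3]. apply cb_le. intros q Hq.
        destruct (G2 q ltac:(lia)) as [-> _]. auto.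
  - auto.
Qed.

Lemma find_best_spec s : env s ->
  ptot find_best s (8 * n + 6) (fun s' => rv s' 5 = 0%R /\ (0 <= rv s' 4)%R /\
    (forall p, p < n -> (av s 2 p <= rv s' 4)%R) /\
    ((0 < rv s' 4)%R -> nv s' 6 < n /\ av s 2 (nv s' 6) = rv s' 4)).
Proof.
  intros He. unfold find_best.
  eapply tot_blk_then with (T2 := 8 * n + 2); [now split | | cbn [length]; lia].
  set (s1 := acts _ _ _). assert (He1 : env s1) by envt.
  apply tot_for with (Inv := fun i s' => (0 <= rv s' 4)%R /\
      (forall p, p < i -> (av s 2 p <= rv s' 4)%R) /\
      ((0 < rv s' 4)%R -> nv s' 6 < n /\ av s 2 (nv s' 6) = rv s' 4))
    (a := 0) (N := n) (c := 5); try reflexivity; try apply He1.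
  - unfold s1. ev. rewrite (env2 _ He). lia.
  - lia.
  - unfold s1. ev. repeat split; try lra; intros; lia.
  - lia.
  - intros i s2 Hi F2 Ei (H1 & H2 & H3). assert (He2 : env s2) by envt.
    assert (EA : av s2 2 = av s 2) by (frame; reflexivity).
    assert (E5 : rv s2 5 = 0%R) by (frame; reflexivity).
    eapply tot_blk_then with (T2 := 4); [ev; rewrite Ei; cbn [sizes]; lia | | cbn; lia].
    apply tot_if with (T := 2); [| |lia]; ev; rewrite Ei, EA; intros Hv;
      destruct (Rlt_dec _ _) as [Hlt|Hge] in Hv; try discriminate.
    + apply tot_blk; [now split | cbn; lia |].
      ev. rewrite ?EA, E5, (env2 _ He2), Rplus_0_r, Nat.add_0_r, ?Ei.
      repeat split; auto; try lia; try lra.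
      intros p Hp. destruct (Nat.eq_dec p i) as [->|Hn]; [lra|].
      specialize (H2 p ltac:(lia)). lra.
    + ev. repeat split; auto; try apply H3; auto.
      intros p Hp. destruct (Nat.eq_dec p i) as [->|Hn]; [lra | apply H2; lia].
  - intros s2 F2 Ei (H1 & H2 & H3). split; [frame; reflexivity | auto].
Qed.

Lemma write_ball_spec s m b : env s -> nv s 5 = m -> nv s 6 = b -> m < n -> b < n ->
  ptot write_ball s (7 * d + 8) (fun s' => nv s' 5 = S m /\ rv s' 4 = av s 1 b /\
    (forall l, l < d -> av s' 6 (m * (d + 1) + l) = pt b l) /\
    av s' 6 (m * (d + 1) + d) = av s 1 b /\
    (forall a, a < m * (d + 1) -> av s' 6 a = av s 6 a)).
Proof.
  intros He Em Eb Hm Hb. unfold write_ball.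
  assert (Hsz : m * (d + 1) + (d + 1) <= n * (d + 1)).
  { replace (m * (d + 1) + (d + 1)) with (S m * (d + 1)) by lia.
    apply Nat.mul_le_mono_r. lia. }
  eapply tot_blk_then with (T2 := 7 * d + 5); [now split | | cbn [length]; lia].
  set (s1 := acts _ _ _). assert (He1 : env s1) by envt.
  apply tot_then with (T1 := 7 * d + 2) (T2 := 3)
    (Q1 := fun s' => nv s' 10 = m * (d + 1) + d /\
      (forall l, l < d -> av s' 6 (m * (d + 1) + l) = pt b l) /\
      (forall a, a < m * (d + 1) -> av s' 6 a = av s 6 a)).
  3: lia.
  - apply tot_for with (Inv := fun i s' => nv s' 9 = b * d + i /\
        nv s' 10 = m * (d + 1) + i /\
        (forall l, l < i -> av s' 6 (m * (d + 1) + l) = pt b l) /\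
        (forall a, a < m * (d + 1) -> av s' 6 a = av s 6 a))
      (a := 0) (N := d) (c := 4); try reflexivity; try apply He1.
    + unfold s1. ev. rewrite (env2 _ He). lia.
    + lia.
    + unfold s1. ev. rewrite Em, Eb, (env4 _ He), (env22 _ He).
      repeat split; auto; intros; lia.
    + lia.
    + intros i s2 Hi F2 Ei (E9 & E10 & H1 & H2). assert (He2 : env s2) by envt.
      pose proof (index_bound b i Hb ltac:(lia)).
      apply tot_blk; [| cbn; lia |].
      * ev. rewrite E9, E10. cbn [sizes]. lia.
      * ev. rewrite E9, E10, (env3 _ He2). repeat split; try lia.
        -- intros l Hl. unfold updR.
           destruct (Nat.eqb_spec (m * (d + 1) + l) (m * (d + 1) + i)) as [E|E].
           ++ rewrite (env_pt _ He2) by lia. f_equal. lia.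
           ++ apply H1. lia.
        -- intros a Ha. unfold updR.
           destruct (Nat.eqb_spec a (m * (d + 1) + i)); [lia | auto].
    + intros s2 F2 Ei (E9 & E10 & H1 & H2). auto.
  - intros s2 F2 (E10 & H1 & H2). assert (He2 : env s2) by envt.
    assert (E6 : nv s2 6 = b) by (frame; exact Eb).
    assert (E5 : nv s2 5 = m) by (frame; exact Em).
    assert (E1 : av s2 1 = av s 1) by (frame; reflexivity).
    apply tot_blk; [ev; rewrite E6, E10; cbn [sizes]; lia | cbn; lia |].
    ev. rewrite E5, E6, E10, E1, (env3 _ He2). repeat split; try lia.
    + intros l Hl. unfold updR.
      destruct (Nat.eqb_spec (m * (d + 1) + l) (m * (d + 1) + d)); [lia | auto].
    + unfold updR. now rewrite Nat.eqb_refl.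
    + intros a Ha. unfold updR.
      destruct (Nat.eqb_spec a (m * (d + 1) + d)); [lia | auto].
Qed.

(** Strict, so that balls which merely touch may both be chosen. *)
Definition met (r : nat -> R) (b x : nat) : bool :=
  below (r x + r b)%R (edist d (pt x) (pt b)).

Lemma remove_met_spec s b : env s -> nv s 6 = b -> b < n -> rv s 4 = av s 1 b ->
  rv s 5 = 0%R ->
  ptot remove_met s (n * (12 * d + 14) + 3) (fun s' => forall x, x < n ->
    av s' 2 x = if met (av s 1) b x then 0%R else av s 2 x).
Proof.
  intros He Eb Hb E4 E5. unfold remove_met.
  eapply tot_blk_then with (T2 := n * (12 * d + 14) + 2); [now split | | cbn [length]; lia].
  set (s1 := acts _ _ _). assert (He1 : env s1) by envt.
  apply tot_for with (Inv := fun i s' => forall x, x < n ->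
      av s' 2 x = if (x <? i) && met (av s 1) b x then 0%R else av s 2 x)
    (a := 0) (N := n) (c := 12 * d + 5 + 6); try reflexivity; try apply He1.
  - unfold s1. ev. rewrite (env2 _ He). lia.
  - lia.
  - lia.
  - intros i s2 Hi F2 Ei HI. assert (He2 : env s2) by envt.
    assert (E6 : nv s2 6 = b) by (frame; exact Eb).
    eapply tot_then with (T2 := 6); [apply (dist_spec s2 b i); auto; lia | | lia].
    intros s3 F3 E0. assert (He3 : env s3) by envt.
    assert (G7 : nv s3 7 = i) by (frame; exact Ei).
    assert (G1 : av s3 1 = av s 1) by (frame; reflexivity).
    assert (G2 : av s3 2 = av s2 2) by (frame; reflexivity).
    assert (G4 : rv s3 4 = av s 1 b) by (frame; exact E4).
    assert (G5 : rv s3 5 = 0%R) by (frame; exact E5).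
    eapply tot_blk_then with (T2 := 4); [ev; rewrite G7; cbn [sizes]; lia | | cbn; lia].
    assert (Hstep : forall x, x < n -> x <> i -> ((x <? S i) = (x <? i))).
    { intros x Hx Hn. destruct (Nat.ltb_spec x (S i)), (Nat.ltb_spec x i); auto; lia. }
    assert (Hii : (i <? S i) = true) by (apply Nat.ltb_lt; lia).
    apply tot_if with (T := 1); [| |lia]; ev; rewrite G7, G1, G4, E0; intros Hv;
      destruct (Rlt_dec _ _) as [Hlt|Hge] in Hv; try discriminate.
    + apply tot_blk; [ev; rewrite G7; cbn [sizes]; lia | cbn; lia |].
      ev. rewrite G7, G2, G5. intros x Hx. unfold updR.
      destruct (Nat.eqb_spec x i) as [->|Hn].
      * rewrite Hii. unfold met. replace (below _ _) with true; [reflexivity|].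
        symmetry. now apply below_true.
      * now rewrite HI, Hstep.
    + ev. rewrite G2. intros x Hx. rewrite HI by assumption.
      destruct (Nat.eq_dec x i) as [->|Hn]; [|now rewrite Hstep].
      replace (met (av s 1) b i) with false; [now rewrite !andb_false_r|].
      unfold met, below. destruct (Rlt_dec _ _); [contradiction | reflexivity].
  - intros s2 F2 Ei HI x Hx. rewrite HI by assumption.
    apply Nat.ltb_lt in Hx. now rewrite Hx.
Qed.

(** * Accounting for the greedy selection *)

Definition cells : nat := 2 * (9 * (d + 1)) ^ d.

Definition balls_at (r : nat -> R) (out : nat -> R) (m : nat) (c : nat -> nat) : Prop :=
  (forall j, j < m -> c j < n /\
     (forall l, l < d -> out (j * (d + 1) + l) = pt (c j) l) /\
     out (j * (d + 1) + d) = r (c j)) /\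
  (forall i j, i < m -> j < m -> i <> j ->
     (r (c i) + r (c j) <= edist d (pt (c i)) (pt (c j)))%R).

Lemma balls_at_extend r out out' m c b :
  balls_at r out m c -> b < n ->
  (forall a, a < m * (d + 1) -> out' a = out a) ->
  (forall l, l < d -> out' (m * (d + 1) + l) = pt b l) ->
  out' (m * (d + 1) + d) = r b ->
  (forall j, j < m -> (r b + r (c j) <= edist d (pt b) (pt (c j)))%R) ->
  balls_at r out' (S m) (fun j => if Nat.eqb j m then b else c j).
Proof.
  intros [H1 H2] Hb Ho Hl Hr Hsep.
  assert (Hj : forall j, j < m -> j * (d + 1) + d < m * (d + 1)).
  { intros j Hj. assert (S j * (d + 1) <= m * (d + 1)) by (apply Nat.mul_le_mono_r; lia). lia. }
  split.
  - intros j Hjm. destruct (Nat.eqb_spec j m) as [->|Hn]; [auto|].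
    destruct (H1 j ltac:(lia)) as (A1 & A2 & A3). specialize (Hj j ltac:(lia)).
    split; [assumption | split].
    + intros l Hld. rewrite Ho by lia. auto.
    + rewrite Ho by lia. auto.
  - intros i j Hi Hjm Hn.
    destruct (Nat.eqb_spec i m) as [->|Hi']; destruct (Nat.eqb_spec j m) as [->|Hj'];
      [lia | | |].
    + apply Hsep. lia.
    + rewrite edist_sym, Rplus_comm. apply Hsep. lia.
    + apply H2; lia.
Qed.

Definition alive (v : R) : bool := negb (upto 0 v).

Lemma alive_true v : alive v = true <-> (0 < v)%R.
Proof.
  unfold alive, upto. destruct (Rle_dec v 0); split; try discriminate; lra || auto.
Qed.

(** Among the live points [b] has the largest inverse radius, hence the smallest radius, so every
    point it removes is counted by [larger_meets]. It also removes itself, being at distance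
    [0 < 2 r b]. The first inequality bounds the number of rounds, the second the loss per ball. *)
Lemma alive_drop (g g' : nat -> R) r b :
  (forall p, p < n -> radius_ok p (r p)) -> b < n -> (0 < g b)%R ->
  (forall p, p < n -> (g p <= g b)%R) ->
  (forall p, p < n -> g p = 0%R \/ g p = (1 / r p)%R) ->
  (forall p, p < n -> g' p = if met r b p then 0%R else g p) ->
  S (cnt alive g' 0 n) <= cnt alive g 0 n /\
  cnt alive g 0 n <= cnt alive g' 0 n + cells * (64 * k).
Proof.
  intros Hr Hb Hgb Hmax Hg Hg'.
  assert (Hrb := proj1 (Hr b Hb)).
  assert (alive_met : forall p, p < n -> met r b p = true -> alive (g' p) = false).
  { intros p Hp E. rewrite Hg', E by assumption. unfold alive, upto.
    destruct (Rle_dec 0 0); [reflexivity | lra]. }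
  split.
  - pose proof (cb_upd (fun p => alive (g p)) 0 n b false ltac:(lia)) as H.
    cbn beta in H. replace (alive (g b)) with true in H by (symmetry; now apply alive_true).
    cbn [b2n] in H. rewrite Nat.add_0_r, Nat.add_1_r in H. fold (cnt alive g 0 n) in H.
    rewrite <- H. apply le_n_S, cb_le. intros p Hp E.
    destruct (Nat.eqb_spec p b) as [->|Hn].
    + rewrite alive_met in E; [discriminate | assumption|].
      apply below_true. rewrite edist_refl. lra.
    + destruct (met r b p) eqn:Em; [rewrite alive_met in E by (auto; lia); discriminate|].
      now rewrite Hg', Em in E by lia.
  - unfold cnt at 1. rewrite (cb_split _ (met r b)).
    assert (A1 : cb (fun p => alive (g p) && met r b p) 0 n <= cells * (64 * k)).
    { eapply Nat.le_trans; [|apply (larger_meets_bound d n (64 * k) pt r b); auto].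
      - apply cb_le. intros p Hp E. apply andb_true_iff in E as [E1 E2].
        unfold larger_meets. apply andb_true_iff. split; [|exact E2].
        apply upto_true. apply alive_true in E1.
        pose proof (proj1 (Hr p ltac:(lia))) as Hrp.
        specialize (Hmax p ltac:(lia)).
        destruct (Hg p ltac:(lia)) as [E|E]; [lra|].
        destruct (Hg b Hb) as [E'|E']; [lra|].
        rewrite E, E' in Hmax. unfold Rdiv in Hmax. rewrite !Rmult_1_l in Hmax.
        apply Rnot_lt_le. intros Hlt. apply Rinv_lt_contravar in Hlt; [lra | nra].
      - intros p Hp. apply Hr. assumption.
      - intros p Hp. apply Hr. assumption. }
    assert (A2 : cb (fun p => alive (g p) && negb (met r b p)) 0 n <= cnt alive g' 0 n).
    { apply cb_le. intros p Hp E. apply andb_true_iff in E as [E1 E2].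
      rewrite Hg' by lia. apply negb_true_iff in E2. now rewrite E2. }
    lia.
Qed.

Lemma greedy_spec s : env s ->
  (forall p, p < n -> radius_ok p (av s 1 p) /\ av s 2 p = (1 / av s 1 p)%R) ->
  ptot greedy s (100 * ((n * n) * (d + 1)) + 4) (fun s' =>
    nv s' 5 <= n /\ n <= nv s' 5 * (cells * (64 * k)) /\
    exists c, balls_at (av s 1) (av s' 6) (nv s' 5) c).
Proof.
  intros He Hr. unfold greedy. set (r := av s 1) in *.
  eapply tot_blk_then with (T2 := 100 * ((n * n) * (d + 1)) + 2);
    [now split | | cbn [length]; lia].
  set (s1 := acts _ _ _). assert (He1 : env s1) by envt.
  (* The number of balls is at most [i], which keeps the output in range; every removed point is
     charged to a ball; and at most [n - i] points are live, so none is left after [n] rounds. Live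
     points are separated from all chosen balls. *)
  apply tot_for with (Inv := fun i s' => nv s' 5 <= i /\
      n <= cnt alive (av s' 2) 0 n + nv s' 5 * (cells * (64 * k)) /\
      cnt alive (av s' 2) 0 n <= n - i /\
      exists c, balls_at r (av s' 6) (nv s' 5) c /\
        forall p, p < n -> av s' 2 p = 0%R \/ (av s' 2 p = (1 / r p)%R /\
          forall j, j < nv s' 5 -> (r p + r (c j) <= edist d (pt p) (pt (c j)))%R))
    (a := 0) (N := n) (c := 8 * n + 6 + (7 * d + 8 + (n * (12 * d + 14) + 3) + 2));
    try reflexivity; try apply He1.
  - unfold s1. ev. rewrite (env2 _ He). lia.
  - lia.
  - unfold s1. ev. rewrite (env2 _ He). cbn [Nat.add].
    split; [lia | split; [|split]].
    + unfold cnt. rewrite cb_true; [lia|]. intros p Hp. apply alive_true.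
      destruct (Hr p ltac:(lia)) as [[H _] ->]. apply Rdiv_lt_0_compat; lra.
    + unfold cnt. rewrite Nat.sub_0_r. apply cb_bound.
    + exists (fun j => j). split; [split; intros; lia|].
      intros p Hp. right. split; [apply Hr; assumption | intros; lia].
  - rewrite Nat.sub_0_r. assert (n * 1 <= n * n) by (apply Nat.mul_le_mono_l; lia). nia.
  - intros i s2 Hi F2 Ei (Hm & Hcov & Hal & c & Hc & HG). assert (He2 : env s2) by envt.
    eapply tot_then; [apply (find_best_spec s2 He2) | | apply le_n].
    intros s3 F3 (E5 & Hb0 & Hmax & Hbest). assert (He3 : env s3) by envt.
    assert (A2 : av s3 2 = av s2 2) by (frame; reflexivity).
    assert (A6 : av s3 6 = av s2 6) by (frame; reflexivity).
    assert (A1 : av s3 1 = r) by (frame; reflexivity).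
    assert (B5 : nv s3 5 = nv s2 5) by (frame; reflexivity).
    apply tot_if with (T := 7 * d + 8 + (n * (12 * d + 14) + 3)); [| |lia]; cbn [aval];
      intros Hv; destruct (Rlt_dec _ _) as [Hlt|Hge] in Hv; try discriminate;
      rewrite E5 in *.
    + destruct (Hbest Hlt) as [Hbn Hgb]. set (b := nv s3 6) in *.
      set (m := nv s2 5) in *.
      eapply tot_then; [apply (write_ball_spec s3 m b); auto; lia | | apply le_n].
      intros s4 F4 (G5 & G4 & Gl & Gr & Go). assert (He4 : env s4) by envt.
      rewrite A1 in G4, Gr.
      assert (C1 : av s4 1 = r) by (frame; reflexivity).
      assert (C2 : av s4 2 = av s2 2) by (frame; reflexivity).
      apply tot_framed.
      eapply tot_weaken; [apply (remove_met_spec s4 b); auto | apply le_n |].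
      { frame. reflexivity. }
      { now rewrite C1. }
      { frame. exact E5. }
      intros s5 HR F5.
      assert (D5 : nv s5 5 = S m) by exact (eq_trans (proj1 F5 5 eq_refl) G5).
      assert (D6 : av s5 6 = av s4 6) by exact (proj2 (proj2 F5) 6 eq_refl).
      rewrite C1, C2 in HR.
      destruct (alive_drop (av s2 2) (av s5 2) r b) as [K1 K2]; auto.
      * intros p Hp. apply Hr. assumption.
      * lra.
      * intros p Hp. rewrite Hgb. auto.
      * intros p Hp. destruct (HG p Hp) as [?|[? _]]; auto.
      * ev. rewrite D5, D6.
        split; [lia | split; [nia | split; [lia|]]].
        destruct (HG b Hbn) as [Z|[_ Hsep]]; [lra|].
        exists (fun j => if Nat.eqb j m then b else c j). split.
        -- apply balls_at_extend with (av s2 6); auto. intros a Ha.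
           rewrite Go, A6 by assumption. reflexivity.
        -- intros p Hp. rewrite HR by assumption.
           destruct (met r b p) eqn:Em; [now left|].
           destruct (HG p Hp) as [Z|[Z Zs]]; [now left | right].
           split; [assumption|]. intros j Hj.
           destruct (Nat.eqb_spec j m) as [->|Hn]; [|apply Zs; lia].
           unfold met, below in Em. destruct (Rlt_dec _ _); [discriminate | lra].
    + ev. rewrite A2, A6, B5. split; [lia | split; [assumption | split]].
      * unfold cnt. rewrite cb_false; [lia|]. intros p Hp.
        unfold alive, upto. specialize (Hmax p ltac:(lia)).
        destruct (Rle_dec _ _); [reflexivity | lra].
      * exists c. auto.
  - intros s2 F2 Ei (Hm & Hcov & Hal & c & Hc & _).
    split; [assumption | split; [lia | eauto]].
Qed.

Lemma program_spec s :
  nv s 0 = n -> nv s 1 = k ->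
  (forall a, a < n * d -> av s 0 a = pt (a / d) (a mod d)) ->
  ptot (program d) s (4000 * (200 * ((n * n) * (d + 1)))) (fun s' =>
    (n <= nv s' 5 * (cells * (64 * k)) /\
     exists r c, (forall p, p < n -> radius_ok p (r p)) /\
       balls_at r (av s' 6) (nv s' 5) c) /\
    nv s' 5 <= n).
Proof.
  intros H0 H1 Hp. unfold program.
  assert (Hn2 : 1 <= (n * n) * (d + 1)) by nia.
  eapply tot_blk_then with (T2 := 4000 * (150 * ((n * n) * (d + 1))));
    [now split | | cbn [length]; lia].
  set (s1 := acts _ _ _).
  assert (He1 : env s1).
  { unfold s1. split; ev; auto; try lia. intros i l Hi Hl.
    rewrite Hp by now apply index_bound.
    rewrite (Nat.add_comm (i * d)), Nat.div_add, Nat.Div0.mod_add by lia.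
    rewrite Nat.div_small, Nat.mod_small by assumption. reflexivity. }
  eapply tot_then with (T2 := 100 * ((n * n) * (d + 1)) + 4);
    [apply (radii_spec s1 He1) | | lia].
  intros s2 F2 Hr. assert (He2 : env s2) by envt.
  eapply tot_weaken; [apply (greedy_spec s2 He2 Hr) | apply le_n |].
  intros s3 (G1 & G2 & c & G3). split; [|assumption]. split; [assumption|].
  exists (av s2 1), c. split; [|assumption]. intros p Hpn. now apply Hr.
Qed.

End Program.

Lemma program_wf d : wf (program d) = true.
Proof. reflexivity. Qed.

(** * From the program's specification to the theorem *)

Lemma count_in_cb d n pt c r :
  count_in d n pt c r = cb (fun i => upto r (edist d (pt i) c)) 0 n.
Proof.
  induction n as [|n IH]; cbn [count_in cb Nat.add]; [reflexivity|].
  rewrite IH. f_equal. unfold upto, b2n. now destruct (Rle_dec _ _).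
Qed.

Open Scope R_scope.

Theorem mainTheorem7 :
  forall d : nat,
  exists (prog : list instr) (cst C : R),
    0 < cst /\ 0 < C /\
    forall (n k : nat) (Spts : nat -> nat -> R),
      distinct_pts d n Spts -> (1 <= k)%nat -> (k <= n)%nat ->
      exists t : nat,
        INR t <= C * INR n ^ 2 + C /\
        halted prog (run prog t (init_config d n k Spts)) /\
        good_output d n k Spts cst (run prog t (init_config d n k Spts)).
Proof.
  intros d.
  set (K := (cells d * 64)%nat).
  (* Twice the program's bound [4000 * 200] gives [4000 * 400]; one more unit of 4000 covers the
     copying. [C] is kept abstract so that this large unary number is not evaluated. *)
  assert (exists C, C = (4000 * (401 * (d + 1)))%nat) as [C EC] by eauto.
  assert (HK : 0 < INR K).
  { apply (lt_INR 0). unfold K, cells.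
    assert ((9 * (d + 1)) ^ d <> 0)%nat by (apply Nat.pow_nonzero; lia). lia. }
  assert (HC : 0 < INR C) by (apply (lt_INR 0); lia).
  exists (IConst 3 1 :: compile (assemble d (program d)) 1), (/ INR K), (INR C).
  split; [now apply Rinv_0_lt_compat | split; [assumption|]].
  intros n k Spts Hd Hk Hkn.
  destruct (assemble_run d (program d) n k Spts _ _ (program_wf d)
    (program_spec d n k Spts Hd Hk Hkn)) as (t & Ht & Hh & s & HQ & Hm & Ho).
  exists t. split; [|split; [exact Hh|]].
  - replace (INR C * INR n ^ 2 + INR C) with (INR (C * (n * n) + C))
      by (rewrite plus_INR, !mult_INR; ring).
    apply le_INR. rewrite EC.
    assert (n * 1 <= n * n)%nat by (apply Nat.mul_le_mono_l; lia).
    assert (n * (d + 1) <= n * n * (d + 1))%nat by (apply Nat.mul_le_mono_r; lia). lia.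
  - destruct HQ as (Hcov & r & c & Hr & Hb1 & Hb2).
    unfold good_output. rewrite Hm. set (m := nv s 5) in *.
    match goal with |- context [out_radius d ?x] => set (cf := x) in * end.
    assert (Hrad : forall i, (i < m)%nat -> out_radius d cf i = r (c i)).
    { intros i Hi. destruct (Hb1 i Hi) as (_ & _ & <-). apply Ho. nia. }
    assert (Hcen : forall x i, (i < m)%nat ->
      edist d x (out_center d cf i) = edist d x (Spts (c i))).
    { intros x i Hi. apply edist_ext; auto. intros l Hl.
      destruct (Hb1 i Hi) as (_ & <- & _); auto. apply Ho. nia. }
    split; [|split].
    + assert (Hk0 : 0 < INR k) by (apply (lt_INR 0); lia).
      apply le_INR in Hcov. replace (m * (cells d * (64 * k)))%nat with (m * K * k)%nat in Hcov
        by (unfold K; ring).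
      rewrite !mult_INR in Hcov.
      apply Rmult_le_reg_r with (INR K * INR k); [now apply Rmult_lt_0_compat|].
      replace (/ INR K * INR n / INR k * (INR K * INR k)) with (INR n) by (field; lra).
      lra.
    + intros i Hi. rewrite Hrad by assumption.
      destruct (Hr (c i) (proj1 (Hb1 i Hi))) as (R1 & R2 & _). split; [assumption|].
      rewrite count_in_cb. eapply Nat.le_trans; [exact R2|]. apply cb_le.
      intros q Hq. now rewrite Hcen.
    + intros i j Hi Hj Hn (x & Hx1 & Hx2).
      rewrite Hrad, Hcen in Hx1, Hx2 by assumption.
      specialize (Hb2 i j Hi Hj Hn).
      (* A common interior point would bring the centres closer than the sum of the radii. *)
      pose proof (edist_triangle d (Spts (c i)) x (Spts (c j))) as Ht'.
      rewrite (edist_sym d (Spts (c i)) x) in Ht'. lra.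
Qed.
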